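(* Let $\mathcal{A}$ be a homogeneous constant-coefficient differential operator on $\mathbb{R}^N$ acting on $\mathbb{R}^d$-valued functions, satisfying the constant rank property and the spanning property, and let $\mathcal{B}\colon C^\infty(\mathbb{R}^N,\mathbb{R}^m)\to C^\infty(\mathbb{R}^N,\mathbb{R}^d)$, a constant rank operator of order $k_{\mathcal{B}}$, be a potential of $\mathcal{A}$. Then $M\colon\mathbb{R}^d\to\mathbb{R}$ is $\mathcal{A}$-quasiaffine if and only if $M$ is a polynomial and for all integers $r$ with $$2\le r\le\min\{k_{\mathcal{B}},N\}+1,$$ all linearly dependent $\xi_1,\dots,\xi_r\in\mathbb{R}^N\setminus\{0\}$, all $w_1,\dots,w_r\in\mathbb{R}^m$ and all $x\in\mathbb{R}^d$ one has $$D^rM(x)\big[\mathcal{B}[\xi_1](w_1),\dots,\mathcal{B}[\xi_r](w_r)\big]=0.$$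
   Context: $\mathcal{A}\colon C^\infty(\mathbb{R}^N,\mathbb{R}^d)\to C^\infty(\mathbb{R}^N,\mathbb{R}^l)$ is given by $\mathcal{A}u=\sum_{|\alpha|=k_{\mathcal{A}}}A_\alpha\partial_\alpha u$ with constant coefficients $A_\alpha\in\mathrm{Lin}(\mathbb{R}^d,\mathbb{R}^l)$ and order $k_{\mathcal{A}}\ge 1$. Its Fourier symbol is $\mathcal{A}[\xi]=\sum_{|\alpha|=k_{\mathcal{A}}}\xi^\alpha A_\alpha$, $\xi\in\mathbb{R}^N\setminus\{0\}$. Constant rank property: $\dim\ker\mathcal{A}[\xi]$ is the same for all $\xi\in\mathbb{R}^N\setminus\{0\}$ (and similarly for $\mathcal{B}$). Spanning property: $\bigcup_{\xi\in\mathbb{R}^N\setminus\{0\}}\ker\mathcal{A}[\xi]$ spans $\mathbb{R}^d$. A potential of $\mathcal{A}$ is a homogeneous constant-coefficient differential operator $\mathcal{B}u=\sum_{|\alpha|=k_{\mathcal{B}}}B_\alpha\partial_\alpha u$ of order $k_{\mathcal{B}}\ge 1$ whose symbol $\mathcal{B}[\xi]=\sum_{|\alpha|=k_{\mathcal{B}}}\xi^\alpha B_\alpha\in\mathrm{Lin}(\mathbb{R}^m,\mathbb{R}^d)$ satisfies $\mathrm{Im}\,\mathcal{B}[\xi]=\ker\mathcal{A}[\xi]$ for all $\xi\in\mathbb{R}^N\setminus\{0\}$. $T_N$ is the $N$-torus, $[0,1]^N$ with the usual identification of faces. A function $M\colon\mathbb{R}^d\to\mathbb{R}$ is $\mathcal{A}$-quasiaffine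 if it is continuous and $M(v)=\int_{T_N}M(v+\psi(y))\,dy$ for all $v\in\mathbb{R}^d$ and all $\psi\in C^\infty(T_N,\mathbb{R}^d)$ with $\mathcal{A}\psi=0$ and $\int_{T_N}\psi=0$. $D^rM(x)$ is the $r$-th derivative of $M$ at $x$ viewed as an $r$-linear form on $\mathbb{R}^d$. ''Linearly dependent'' refers to the tuple $(\xi_1,\dots,\xi_r)$ (so a repeated vector makes it dependent). *)

(* Defs.v *)
From HB Require Import structures.
From mathcomp Require Import all_boot all_order all_algebra.
From mathcomp Require Import all_classical all_reals all_analysis.
From mathcomp Require Import -(notations) mpoly.
Import Order.TTheory GRing.Theory Num.Theory.
Import numFieldNormedType.Exports.

Set Implicit Arguments.
Unset Strict Implicit.
Unset Printing Implicit Defensive.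

Local Open Scope classical_set_scope.
Local Open Scope ring_scope.

Definition multi_index (N k : nat) : finType :=
  {alpha : {ffun 'I_N -> 'I_k.+1} | (\sum_(i < N) alpha i)%N == k}.

(* Coefficients of a homogeneous operator of order k from R^d-valued to
   R^l-valued functions on R^N. Vectors are rows, so a linear map
   R^d -> R^l is a d x l matrix acting on the right. *)
Definition hdiffop (R : realType) (N d l k : nat) : Type :=
  multi_index N k -> 'M[R]_(d, l).

Definition partial (R : realType) (N d : nat) (i : 'I_N)
    (u : 'rV[R]_N -> 'rV[R]_d) : 'rV[R]_N -> 'rV[R]_d :=
  fun x => 'D_(delta_mx 0 i : 'rV[R]_N) u x.

Definition partial_multi (R : realType) (N d k : nat) (alpha : multi_index N k)
    (u : 'rV[R]_N -> 'rV[R]_d) : 'rV[R]_N -> 'rV[R]_d :=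
  foldr (fun i f => iter (val alpha i) (partial i) f) u (enum 'I_N).

Definition smooth (R : realType) (N d : nat)
    (u : 'rV[R]_N -> 'rV[R]_d) : Prop :=
  forall s : seq 'I_N,
    continuous (foldr (@partial R N d) u s) /\
    forall (i : 'I_N) (x : 'rV[R]_N),
      derivable (foldr (@partial R N d) u s) x (delta_mx 0 i : 'rV[R]_N).

Definition apply_op (R : realType) (N d l k : nat) (A : hdiffop R N d l k)
    (u : 'rV[R]_N -> 'rV[R]_d) : 'rV[R]_N -> 'rV[R]_l :=
  fun x => \sum_(alpha : multi_index N k) partial_multi alpha u x *m A alpha.

Definition symbol (R : realType) (N d l k : nat) (A : hdiffop R N d l k)
    (xi : 'rV[R]_N) : 'M[R]_(d, l) :=
  \sum_(alpha : multi_index N k)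
     (\prod_(i < N) xi 0 i ^+ val alpha i) *: A alpha.

(* The row space of kermx C is {v | v *m C = 0}. *)
Definition constant_rank (R : realType) (N d l k : nat)
    (A : hdiffop R N d l k) : Prop :=
  forall xi eta : 'rV[R]_N, xi != 0 -> eta != 0 ->
    \rank (kermx (symbol A xi)) = \rank (kermx (symbol A eta)).

Definition spanning (R : realType) (N d l k : nat)
    (A : hdiffop R N d l k) : Prop :=
  exists s : seq 'rV[R]_d,
    (forall v, v \in s ->
       exists xi : 'rV[R]_N, xi != 0 /\ v *m symbol A xi = 0) /\
    span s = fullv.

Definition potential (R : realType) (N m d l kA kB : nat)
    (A : hdiffop R N d l kA) (B : hdiffop R N m d kB) : Prop :=
  forall xi : 'rV[R]_N, xi != 0 -> (symbol B xi == kermx (symbol A xi))%MS.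

Definition unit_periodic (R : realType) (N d : nat)
    (u : 'rV[R]_N -> 'rV[R]_d) : Prop :=
  forall (x : 'rV[R]_N) (i : 'I_N), u (x + delta_mx 0 i) = u x.

(* Iterated Lebesgue integral over [0,1]^N; by Fubini it is the integral over
   the N-torus for the continuous integrands it is used with. *)
Fixpoint torus_integral (R : realType) (N : nat) : ('rV[R]_N -> R) -> R :=
  match N with
  | 0 => fun f => f 0
  | N'.+1 => fun f =>
      \int[@lebesgue_measure R]_(t in `[0, 1])
        torus_integral (fun y : 'rV[R]_N' => f (row_mx (t%:M : 'rV[R]_1) y))
  end.

Definition quasiaffine (R : realType) (N d l k : nat) (A : hdiffop R N d l k)
    (M : 'rV[R]_d -> R) : Prop :=
  continuous M /\
  forall (v : 'rV[R]_d) (psi : 'rV[R]_N -> 'rV[R]_d),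
    smooth psi -> unit_periodic psi ->
    (forall x, apply_op A psi x = 0) ->
    (forall j : 'I_d, torus_integral (fun y => psi y 0 j) = 0) ->
    M v = torus_integral (fun y => M (v + psi y)).

Definition polynomial_fun (R : realType) (d : nat) (M : 'rV[R]_d -> R) : Prop :=
  exists p : mpoly d R, forall x : 'rV[R]_d, M x = meval (fun j => x 0 j) p.

(* D^r M(x)[v_1, ..., v_r], with r the length of the list; the head of the
   list is the direction of the outermost differentiation. *)
Fixpoint iter_diff (R : realType) (d : nat) (M : 'rV[R]_d -> R)
    (vs : seq 'rV[R]_d) : 'rV[R]_d -> R :=
  match vs with
  | [::] => M
  | v :: vs' => fun x => 'd (iter_diff M vs') x v
  end.

(* Main.v *)
(** A smooth periodic mean-zero [A]-free field is a uniform limit of finite sums of [A]-free waves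
    [cos (th + 2 pi n.x) *: u] with [n] a nonzero integer vector and [u] in the kernel of [A[n]],
    which is the image of [B[n]]: convolve with [\prod_i (1 + cos (2 pi x_i)) ^+ K].

    If the derivatives vanish along dependent frequencies, [M] is affine along each amplitude, and
    [M (v + sum of waves)] is a sum of products of cosines times derivatives at [v]. Dependent
    frequencies kill the derivative; a product of cosines with free frequencies has mean zero,
    since a translation changes its sign. Only orders up to [min k N + 1], with [k] the order of [B], are assumed: above
    that, the derivative is a form of degree [k] in the coefficients of the dependence relation,
    it vanishes when one of the more than [k] coefficients is zero, hence it vanishes.

    Conversely, a single wave gives a mean value property along [u], so [M] is affine along [u]; as
    such amplitudes span the space, [M] is a polynomial. Taking differences over subfamilies of
    waves shows that the mean of a product of cosines times the corresponding derivative of [M]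
    is zero, and the mean is positive when the frequencies are [xi_1, ..., xi_r] and their sum. The
    vanishing obtained for integer frequencies and coefficients is a polynomial identity. *)
Require Import Defs.
From HB Require Import structures.
From mathcomp Require Import all_boot all_order all_algebra.
From mathcomp Require Import all_classical all_reals all_analysis.
From mathcomp Require Import lra ring.
From mathcomp Require Import -(notations) mpoly.
Import Order.TTheory GRing.Theory Num.Theory.
Import numFieldNormedType.Exports.

Set Implicit Arguments.
Unset Strict Implicit.
Unset Printing Implicit Defensive.

Local Open Scope classical_set_scope.
Local Open Scope ring_scope.

(** Periodic fields carry integer frequencies only, whereas the spanning property and the condition
    on the derivatives concern real ones. Necessity bridges this gap because [symbol B xi] is
    polynomial in [xi]. It also uses homogeneity: [symbol A] has the same kernel at [xi] and at
    [c *: xi] for nonzero [c], so the amplitude of [xi_i] may travel with the frequency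
    [c_i *: xi_i], and a plain sum of frequencies becomes a combination with positive integer
    coefficients.

    A quasiaffine [M] is at first only continuous, so affinity along an amplitude comes from a
    maximum principle; derivatives enter once [M] is known to be a polynomial.

    Facts about the iterated integral rest on linearity, monotonicity and translation invariance. In
    particular the mean of a derivative vanishes, being close to the mean of a difference quotient.
    For the kernel times a sine this shows that the mean of the kernel against [1 - cos (2 pi x_i)]
    is its total mean over [K + 1]. That is the concentration of the kernel, and the reason why
    moduli of continuity are also measured with the weight [1 - cos]. *)

Lemma norm_rV_le (R : realType) n (x : 'rV[R]_n) (e : R) :
  0 <= e -> (`|x| <= e) <-> (forall i, `|x 0 i| <= e).
Proof.
move=> e0; split=> [xe i|H].
  apply: le_trans xe; rewrite [leRHS]/Num.Def.normr /= mx_normrE.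
  exact: (le_bigmax _ (fun ij => `|x ij.1 ij.2|) (0, i)).
rewrite /Num.Def.normr /= mx_normrE (bigmax_le _ e0)//= => -[i j] _ /=.
by rewrite ord1.
Qed.

(** * Continuous functions periodic under the integer lattice *)

Definition cper (R : realType) n (f : 'rV[R]_n -> R) :=
  continuous f /\ forall x (i : 'I_n), f (x + delta_mx 0 i) = f x.

(** Only [x] is confined to [K]: its neighbour [y] may leave the set, as happens at the faces of the
    unit cube and for approximations of a field with values in [K]. *)
Lemma continuous_compact_modulus (R : realType) n (f : 'rV[R]_n -> R) (K : set 'rV[R]_n) (e : R) :
  compact K -> continuous f -> 0 < e ->
  exists2 d, 0 < d & forall x y : 'rV[R]_n, K x -> `|x - y| <= d -> `|f x - f y| <= e.
Proof.
move=> /compact_near_coveringP cK fc e0.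
case: (cK R (0^'+) (fun d x => forall y, `|x - y| <= d -> `|f x - f y| <= e)).
  move=> x Kx.
  have /cvgrPdist_le/(_ (e / 2)) := fc x.
  rewrite divr_gt0// => /(_ isT)/nbhs_normP[r/= r0 fr].
  exists (ball x (r / 2), [set d | d < r / 2]) => /=.
    split; first by apply: nbhsx_ballx; rewrite divr_gt0.
    by apply: nbhs_right_lt; rewrite divr_gt0.
  move=> [x' d]/= [xx' dr] y x'y.
  have {}xx' : `|x - x'| < r / 2 by move: xx'; rewrite -ball_normE.
  have h1 : `|f x - f x'| <= e / 2 by apply: fr => /=; lra.
  have h2 : `|f x - f y| <= e / 2.
    apply: fr => /=; rewrite -(subrKA x') (le_lt_trans (ler_normD _ _))//; lra.
  have -> : f x' - f y = (f x - f y) - (f x - f x') by ring.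
  apply: le_trans (ler_normB _ _) _; lra.
move=> r/= r0 H; exists (r / 2); first lra.
move=> x y Kx xy; apply: (H (r / 2)) => //=; last lra.
by rewrite sub0r normrN gtr0_norm; lra.
Qed.

Section periodic.
Context {R : realType} {n : nat} {f : 'rV[R]_n -> R}.

Lemma periodic_int_shift : (forall x (i : 'I_n), f (x + delta_mx 0 i) = f x) ->
  forall (z : 'rV[R]_n), (forall i, z 0 i \is a Num.int) ->
  forall x, f (x + z) = f x.
Proof.
move=> fp.
have nat1 (m : nat) i x : f (x + m%:R *: delta_mx 0 i) = f x.
  elim: m x => [|m IH] x; first by rewrite scale0r addr0.
  by rewrite -natr1 scalerDl scale1r addrA fp IH.
have int1 (z : int) i x : f (x + z%:~R *: delta_mx 0 i) = f x.
  case: z => m; first exact: nat1.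
  by rewrite NegzE mulrNz scaleNr -(nat1 m.+1 i (x - _)) subrK.
move=> z zi x; rewrite [z]row_sum_delta.
suff : forall (s : seq 'I_n) y, f (y + \sum_(i <- s) z 0 i *: delta_mx 0 i) = f y by exact.
elim=> [|i s IH] y; first by rewrite big_nil addr0.
by rewrite big_cons addrA IH; have /intrP[m ->] := zi i; rewrite int1.
Qed.

Lemma cper_unif_continuous : cper f -> forall e, 0 < e ->
  exists2 d, 0 < d & forall x y : 'rV[R]_n, `|x - y| <= d -> `|f x - f y| <= e.
Proof.
move=> [fc fp] e e0.
have cK : compact [set v : 'rV[R]_n | forall i, v ord0 i \in `[0%R, 1%R]%R].
  by apply: (@rV_compact R n (fun=> `[0%R, 1%R]%classic)) => _; exact: segment_compact.
have [d d0 H] := continuous_compact_modulus cK fc e0.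
exists d => // x y xy.
(* One integer translation brings [x] into the unit cube and carries [y] along at the same
   distance. *)
pose z : 'rV[R]_n := \row_i - (Num.floor (x 0 i))%:~R.
have zi i : z 0 i \is a Num.int by rewrite mxE rpredN intr_int.
rewrite -(periodic_int_shift fp zi x) -(periodic_int_shift fp zi y).
apply: H => [i|].
- rewrite !mxE in_itv/= subr_ge0 ge_floor/= lerBlDl.
  by have /andP[_ /ltW] := floor_itv (x 0 i); rewrite intrD.
- by rewrite opprD addrACA subrr addr0.
Qed.

End periodic.

Lemma cper_cst (R : realType) n (c : R) : cper (fun _ : 'rV[R]_n => c).
Proof. by split=> [|//]; exact: cst_continuous. Qed.

Lemma cperD (R : realType) n (f g : 'rV[R]_n -> R) :
  cper f -> cper g -> cper (fun x => f x + g x).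
Proof.
by move=> [fc fp] [gc gp]; split=> [x|x i]; [apply: continuousD; [exact: fc|exact:
  gc]|rewrite fp gp].
Qed.

Lemma cperM (R : realType) n (f g : 'rV[R]_n -> R) :
  cper f -> cper g -> cper (fun x => f x * g x).
Proof.
by move=> [fc fp] [gc gp]; split=> [x|x i]; [apply: continuousM; [exact: fc|exact:
  gc]|rewrite fp gp].
Qed.

Lemma cper_comp (R : realType) n (f : 'rV[R]_n -> R) (h : R -> R) :
  continuous h -> cper f -> cper (fun x => h (f x)).
Proof.
move=> hc [fc fp]; split=> [x|x i]; last by rewrite fp.
by apply: (@continuous_comp _ _ _ f h); [exact: fc|exact: hc].
Qed.

Lemma cperZ (R : realType) n (f : 'rV[R]_n -> R) c :
  cper f -> cper (fun x => c * f x).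
Proof. by move=> cf; apply: cperM => //; exact: cper_cst. Qed.

Lemma cperN (R : realType) n (f : 'rV[R]_n -> R) :
  cper f -> cper (fun x => - f x).
Proof.
by move=> [fc fp]; split=> [x|x i]; [apply: continuousN; exact: fc|rewrite fp].
Qed.

Lemma cperB (R : realType) n (f g : 'rV[R]_n -> R) :
  cper f -> cper g -> cper (fun x => f x - g x).
Proof. by move=> cf cg; apply: cperD => //; exact: cperN. Qed.

Lemma cper_norm (R : realType) n (f : 'rV[R]_n -> R) :
  cper f -> cper (fun x => `|f x|).
Proof. by move=> cf; apply: cper_comp => //; exact: norm_continuous. Qed.

Lemma cper_sum (R : realType) n (I : Type) (s : seq I) (f : I -> 'rV[R]_n -> R) :
  (forall i, cper (f i)) -> cper (fun x => \sum_(i <- s) f i x).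
Proof.
move=> cf; elim: s => [|i s IH].
  by under [X in cper X]funext do rewrite big_nil; exact: cper_cst.
by under [X in cper X]funext do rewrite big_cons; exact: cperD.
Qed.

Lemma cper_prod (R : realType) n (I : Type) (s : seq I) (f : I -> 'rV[R]_n -> R) :
  (forall i, cper (f i)) -> cper (fun x => \prod_(i <- s) f i x).
Proof.
move=> cf; elim: s => [|i s IH].
  by under [X in cper X]funext do rewrite big_nil; exact: cper_cst.
by under [X in cper X]funext do rewrite big_cons; exact: cperM.
Qed.

Lemma cper_shift (R : realType) n (f : 'rV[R]_n -> R) a :
  cper f -> cper (fun x => f (x + a)).
Proof.
move=> [fc fp]; split=> [x|x i]; last by rewrite addrAC fp.
apply: (@continuous_comp _ _ _ (fun y : 'rV[R]_n => y + a) f); last exact: fc.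
by apply: continuousD; [exact: cvg_id|exact: cst_continuous].
Qed.

(** * Integration over the torus *)

Lemma continuous_of_modulus (R : realType) (V W : normedModType R) (f : V -> W) :
  (forall e : R, 0 < e -> exists2 d : R, 0 < d & forall x y, `|x - y| <= d -> `|f x - f y| <= e) ->
  continuous f.
Proof.
move=> H x; apply/cvgrPdist_le => e e0; have [d d0 fd] := H e e0.
by apply/nbhs_normP; exists d => //= y /= xy; exact/fd/ltW.
Qed.

Lemma norm_row_mx_le (R : realType) n (s t d : R) (x y : 'rV[R]_n) : 0 <= d ->
  `|s - t| <= d -> `|x - y| <= d ->
  `|(row_mx (s%:M : 'rV[R]_1) x - row_mx (t%:M : 'rV[R]_1) y : 'rV[R]_(1 + n))| <= d.
Proof.
move=> d0 std xyd; apply/norm_rV_le => // i; rewrite !mxE.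
case: splitP => j _; first by rewrite !mxE ord1 eqxx.
by have /norm_rV_le := xyd => /(_ d0 j); rewrite !mxE.
Qed.

Section slice.
Context {R : realType} {n : nat}.
Implicit Types f g : 'rV[R]_n.+1 -> R.

Definition slice f (t : R) (y : 'rV[R]_n) : R := f (row_mx (t%:M : 'rV[R]_1) y).

Lemma torus_integralS f :
  torus_integral f = \int[@lebesgue_measure R]_(t in `[0, 1]) torus_integral (slice f t).
Proof. by []. Qed.

Lemma slice_unif f : cper f -> forall e, 0 < e -> exists2 d, 0 < d &
  forall s t x y, `|s - t| <= d -> `|x - y| <= d -> `|slice f s x - slice f t y| <= e.
Proof.
move=> cf e e0; have [d d0 H] := cper_unif_continuous cf e0.
by exists d => // s t x y std xyd; apply/H/norm_row_mx_le => //; exact/ltW.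
Qed.

Lemma cper_slice f t : cper f -> cper (slice f t).
Proof.
move=> cf; split.
  apply: continuous_of_modulus => e e0; have [d d0 H] := slice_unif cf e0.
  by exists d => // x y xy; apply: H => //; rewrite subrr normr0 ltW.
move=> x i; rewrite /slice -[RHS](cf.2 _ (rshift 1 i)); congr f.
apply/rowP => j; rewrite !mxE; case: splitP => k jk; rewrite !mxE.
  by rewrite !ord1 (_ : (j == rshift 1 i) = false) ?addr0//; apply/eqP => /(congr1 val)/=;
    rewrite jk; case: k {jk} => -[].
by congr (_ + _%:R); rewrite -[j == _]val_eqE /= jk -[k == i]val_eqE /= eqn_add2l.
Qed.

Lemma slice_per f t : cper f -> slice f (t + 1) = slice f t.
Proof.
move=> cf; apply/funext => x; rewrite /slice -[RHS](cf.2 _ (lshift n (0 : 'I_1))); congr f.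
apply/rowP => j; rewrite !mxE; case: splitP => k jk; rewrite ?mxE.
  by rewrite !ord1 eqxx /= (_ : j = lshift n (0 : 'I_1)) ?eqxx//; apply/val_inj; rewrite /= jk ord1.
by rewrite (_ : (j == lshift n (0 : 'I_1)) = false) ?addr0//; apply/eqP => /(congr1 val)/=;
  rewrite jk.
Qed.

End slice.

Lemma integrable01 (R : realType) (g : R -> R) : continuous g ->
  (@lebesgue_measure R).-integrable `[0, 1] (EFin \o g).
Proof.
move=> cg; apply: continuous_compact_integrable; first exact: segment_compact.
exact: continuous_subspaceT.
Qed.

(** The five facts need each other: additivity in dimension [n.+1] requires the inner integral to be
    continuous, hence integrable, in the outer variable, and this continuity follows from the
    uniform modulus of a periodic function together with additivity, monotonicity and the value on
    constants in dimension [n]. *)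
Lemma torus_integral_linear_monotone (R : realType) n :
  [/\ forall f g : 'rV[R]_n -> R, cper f -> cper g ->
        torus_integral (fun x => f x + g x) = torus_integral f + torus_integral g,
      forall c (f : 'rV[R]_n -> R), cper f ->
        torus_integral (fun x => c * f x) = c * torus_integral f,
      forall f g : 'rV[R]_n -> R, cper f -> cper g -> (forall x, f x <= g x) ->
        torus_integral f <= torus_integral g,
      forall c, torus_integral (fun _ : 'rV[R]_n => c) = c &
      forall f : 'rV[R]_n.+1 -> R, cper f -> continuous (fun t => torus_integral (slice f t))].
Proof.
have cont m :
    (forall f g : 'rV[R]_m -> R, cper f -> cper g ->
        torus_integral (fun x => f x + g x) = torus_integral f + torus_integral g) ->
    (forall f g : 'rV[R]_m -> R, cper f -> cper g -> (forall x, f x <= g x) ->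
        torus_integral f <= torus_integral g) ->
    (forall c, torus_integral (fun _ : 'rV[R]_m => c) = c) ->
    forall f : 'rV[R]_m.+1 -> R, cper f -> continuous (fun t => torus_integral (slice f t)).
  move=> addJ leJ cstJ f cf; apply: continuous_of_modulus => e e0.
  have [d d0 H] := slice_unif cf e0; exists d => // s t st.
  have le1 a b : `|a - b| <= d -> torus_integral (slice f a) <= torus_integral (slice f b) + e.
    move=> ab; rewrite -[X in _ + X](cstJ e) -addJ; [|exact: cper_slice|exact: cper_cst].
    apply: leJ => [||x]; [exact: cper_slice|apply: cperD; [exact: cper_slice|exact: cper_cst]|].
    have := H a b x x ab; rewrite subrr normr0 => /(_ (ltW d0)).
    by rewrite ler_norml => /andP[_]; rewrite lerBlDl addrC.
  rewrite ler_norml; have := le1 s t st; have := le1 t s; rewrite distrC => /(_ st).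
  by move=> ? ?; apply/andP; split; lra.
elim: n => [|n [addJ sclJ leJ cstJ conJ]].
  have addJ (f g : 'rV[R]_0 -> R) : cper f -> cper g ->
    torus_integral (fun x => f x + g x) = torus_integral f + torus_integral g by [].
  have leJ (f g : 'rV[R]_0 -> R) : cper f -> cper g -> (forall x, f x <= g x) ->
        torus_integral f <= torus_integral g by move=> _ _ /(_ 0).
  by split => //; apply: cont.
have addJ' (f g : 'rV[R]_n.+1 -> R) : cper f -> cper g ->
    torus_integral (fun x => f x + g x) = torus_integral f + torus_integral g.
  move=> cf cg; rewrite !torus_integralS -RintegralD//;
    [|exact/integrable01/conJ|exact/integrable01/conJ].
  by apply: eq_Rintegral => t _; rewrite -addJ//; exact: cper_slice.
have leJ' (f g : 'rV[R]_n.+1 -> R) : cper f -> cper g -> (forall x, f x <= g x) ->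
        torus_integral f <= torus_integral g.
  move=> cf cg fg; rewrite !torus_integralS; apply: le_Rintegral => //;
    [exact/integrable01/conJ|exact/integrable01/conJ|].
  by move=> t _; apply: leJ => [||x]; [exact: cper_slice|exact: cper_slice|exact: fg].
have cstJ' c : torus_integral (fun _ : 'rV[R]_n.+1 => c) = c.
  rewrite torus_integralS; under eq_Rintegral do rewrite /slice cstJ.
  by rewrite Rintegral_cst//= lebesgue_measure_itv/= lte01 oppr0 adde0 mulr1.
split => //; last exact: cont.
move=> c f cf; rewrite !torus_integralS -RintegralZl//; last exact/integrable01/conJ.
by apply: eq_Rintegral => t _; rewrite -sclJ//; exact: cper_slice.
Qed.

Section torus_integral_theory.
Context {R : realType} {n : nat}.
Implicit Types f g : 'rV[R]_n -> R.

Lemma torus_integralD f g : cper f -> cper g ->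
  torus_integral (fun x => f x + g x) = torus_integral f + torus_integral g.
Proof. by have [H _ _ _ _] := torus_integral_linear_monotone R n; exact: H. Qed.

Lemma torus_integralZ c f : cper f ->
  torus_integral (fun x => c * f x) = c * torus_integral f.
Proof. by have [_ H _ _ _] := torus_integral_linear_monotone R n; exact: H. Qed.

Lemma le_torus_integral f g : cper f -> cper g -> (forall x, f x <= g x) ->
  torus_integral f <= torus_integral g.
Proof. by have [_ _ H _ _] := torus_integral_linear_monotone R n; exact: H. Qed.

Lemma torus_integral_cst c : torus_integral (fun _ : 'rV[R]_n => c) = c.
Proof. by have [_ _ _ H _] := torus_integral_linear_monotone R n; exact: H. Qed.

Lemma torus_integral_slice_continuous (f : 'rV[R]_n.+1 -> R) : cper f ->
  continuous (fun t => torus_integral (slice f t)).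
Proof. by have [_ _ _ _ H] := torus_integral_linear_monotone R n; exact: H. Qed.

Lemma torus_integralB f g : cper f -> cper g ->
  torus_integral (fun x => f x - g x) = torus_integral f - torus_integral g.
Proof.
move=> cf cg; rewrite -[X in _ - X]mul1r -mulNr -torus_integralZ// -torus_integralD//;
  last exact: cperZ.
by congr torus_integral; apply/funext => x; rewrite mulN1r.
Qed.

Lemma torus_integral_sum (I : Type) (s : seq I) (f : I -> 'rV[R]_n -> R) :
  (forall i, cper (f i)) ->
  torus_integral (fun x => \sum_(i <- s) f i x) = \sum_(i <- s) torus_integral (f i).
Proof.
move=> cf; elim: s => [|i s IH].
  by under [X in torus_integral X]funext do rewrite big_nil; rewrite torus_integral_cst big_nil.
under [X in torus_integral X]funext do rewrite big_cons.
by rewrite torus_integralD ?IH ?big_cons//; exact: cper_sum.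
Qed.

Lemma normr_torus_integral_le f c : cper f -> (forall x, `|f x| <= c) ->
  `|torus_integral f| <= c.
Proof.
move=> cf fc; rewrite ler_norml -(torus_integral_cst c) -mulN1r -torus_integralZ; last exact:
  cper_cst.
apply/andP; split; apply: le_torus_integral => //; try exact: cper_cst.
  by move=> x; rewrite mulN1r; have := fc x; rewrite ler_norml => /andP[].
by move=> x; have := fc x; rewrite ler_norml => /andP[].
Qed.

End torus_integral_theory.

(** With [F] a primitive, the integral shifted by [c] is [F (1 + c) - F c], whose derivative in [c]
    is zero by periodicity. *)
Lemma Rintegral_periodic_shift (R : realType) (g : R -> R) (a : R) :
  continuous g -> (forall t, g (t + 1) = g t) ->
  \int[@lebesgue_measure R]_(t in `[0, 1]) g (t + a) =
  \int[@lebesgue_measure R]_(t in `[0, 1]) g t.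
Proof.
have pos (h : R -> R) b : 0 <= b -> continuous h -> (forall t, h (t + 1) = h t) ->
  \int[@lebesgue_measure R]_(t in `[0, 1]) h (t + b) =
  \int[@lebesgue_measure R]_(t in `[0, 1]) h t.
  move=> b0 ch hp.
  have chs c : continuous (fun t => h (t + c)).
    move=> x; apply: (@continuous_comp _ _ _ (fun t : R => t + c) h); last exact: ch.
    by apply: continuousD; [exact: cvg_id|exact: cst_continuous].
  (* The margins at [-1] and [b + 3] make [F] differentiable around every point of [[0, b + 1]],
     endpoints included. *)
  pose F y := \int[@lebesgue_measure R]_(t in `[(-1)%R, y]) h t.
  have F' y : -1 < y -> y < b + 3 -> is_derive y 1 F (h y).
    move=> y1 yb.
    have ih : (@lebesgue_measure R).-integrable `[(-1)%R, b + 3] (EFin \o h).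
      by apply: continuous_compact_integrable; [exact: segment_compact|exact: continuous_subspaceT].
    have [dF F'y] := @continuous_FTC1_closed R h (-1) y _ yb ih y1 (ch y).
    by apply: DeriveDef; [exact: dF|rewrite -derive1E; exact: F'y].
  have Fs y c : -1 < y + c -> y + c < b + 3 -> is_derive y 1 (fun t => F (t + c)) (h (y + c)).
    move=> y1 yb; have := F' _ y1 yb => dF.
    have := @is_derive1_comp R F (shift c) y (h (y + c)) 1 dF (is_derive_shift y 1 c).
    by rewrite mulr1.
  have I c : 0 <= c -> c <= b ->
      \int[@lebesgue_measure R]_(t in `[0, 1]) h (t + c) = F (1 + c) - F (0 + c).
    move=> c0 cb.
    rewrite /Rintegral (@continuous_FTC2 R _ (fun t => F (t + c)) 0 1)//.
    - exact: continuous_subspaceT.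
    - split.
      + move=> x; rewrite in_itv/= => /andP[x0 x1].
        by have [||H _] := Fs x c; [lra|lra|].
      + apply: cvg_at_right_filter.
        have [||H _] := Fs 0 c; [lra|lra|].
        by move/derivable1_diffP/differentiable_continuous : H.
      + apply: cvg_at_left_filter.
        have [||H _] := Fs 1 c; [lra|lra|].
        by move/derivable1_diffP/differentiable_continuous : H.
    - move=> x; rewrite in_itv/= => /andP[x0 x1].
      by rewrite derive1E; have [||_ H] := Fs x c; [lra|lra|].
  have -> : \int[@lebesgue_measure R]_(t in `[0, 1]) h t =
            \int[@lebesgue_measure R]_(t in `[0, 1]) h (t + 0).
    by apply: eq_Rintegral => t _; rewrite addr0.
  rewrite !I//.
  pose H c := F (1 + c) - F (0 + c).
  have dH c : c \in `[0, b] -> is_derive c 1 H 0.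
    rewrite in_itv/= => /andP[c0 cb].
    have d1 : is_derive c 1 (fun t => F (t + 1)) (h (c + 1)) by apply: Fs; lra.
    have d0 : is_derive c 1 (fun t => F (t + 0)) (h (c + 0)) by apply: Fs; lra.
    have := is_deriveB d1 d0; rewrite hp addr0 subrr.
    by congr is_derive; apply/funext => t; rewrite /H ![_ + t]addrC.
  have cH : {within `[0, b], continuous H}.
    apply: continuous_in_subspaceT => c; rewrite inE => /dH[+ _].
    by move/derivable1_diffP/differentiable_continuous.
  have dH' c : c \in `]0, b[ -> is_derive c 1 H 0 by move/subset_itv_oo_cc; exact: dH.
  have [c _] := MVT_segment b0 dH' cH.
  by rewrite /H mul0r => /eqP; rewrite subr_eq0 => /eqP.
move=> cg gp.
have [a0|a0] := leP 0 a; first exact: pos.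
(* A negative shift is undone by a positive one. *)
have := pos (fun t => g (t + a)) (- a).
rewrite oppr_ge0 ltW// => /(_ isT) <-.
- by apply: eq_Rintegral => t _; rewrite addrNK.
- move=> x; apply: (@continuous_comp _ _ _ (fun t : R => t + a) g); last exact: cg.
  by apply: continuousD; [exact: cvg_id|exact: cst_continuous].
- by move=> t; rewrite addrAC gp.
Qed.

Lemma torus_integral_shift (R : realType) n (f : 'rV[R]_n -> R) (a : 'rV[R]_n) :
  cper f -> torus_integral (fun x => f (x + a)) = torus_integral f.
Proof.
elim: n f a => [|n IH] f a cf; first by rewrite /= thinmx0.
rewrite !torus_integralS.
rewrite -(@Rintegral_periodic_shift _ (fun t => torus_integral (slice f t)) (a 0 (lshift n (0 :
  'I_1)))).
- apply: eq_Rintegral => t _; rewrite -[RHS](IH _ (@rsubmx R 1 1 n a)); last exact: cper_slice.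
  congr torus_integral; apply/funext => y; rewrite /slice -[in LHS](@hsubmxK R 1 1 n a).
  congr f; rewrite [LHS](@add_row_mx R 1 1 n); apply: (congr2 (@row_mx R 1 1 n)) => //.
  by apply/matrixP => i j; rewrite !ord1 !mxE.
- exact: torus_integral_slice_continuous.
- by move=> t; rewrite slice_per.
Qed.

Lemma is_derive_line (R : realType) (V W : normedModType R) (h : V -> W) (x v : V) (t : R) :
  derivable h (x + t *: v) v ->
  is_derive t (1 : R) (fun s => h (x + s *: v)) ('D_v h (x + t *: v)).
Proof.
have E : (fun u => u^-1 *: (h (u *: v + (x + t *: v)) - h (x + t *: v))) =
   (fun u => u^-1 *: (h (x + (u *: (1 : R) + t) *: v) - h (x + t *: v))).
  by apply/funext => u; rewrite [u *: 1]mulr1 scalerDl addrCA.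
move=> dh; apply: DeriveDef; first by rewrite /derivable -E.
by rewrite /derive -E.
Qed.

(** By translation invariance [h (x + s *: v) - h x] has mean zero; by the mean value theorem and
    uniform continuity it differs from [s * 'D_v h x] by at most [s * e]. *)
Lemma torus_integral_derive0 (R : realType) n (h : 'rV[R]_n -> R) (v : 'rV[R]_n) :
  cper h -> (forall x, derivable h x v) -> cper (fun x => 'D_v h x) ->
  torus_integral (fun x => 'D_v h x) = 0.
Proof.
move=> ch dh cdh; apply/eqP; rewrite -normr_le0; apply/ler_addgt0Pl => e e0.
rewrite addr0.
have [d d0 H] := cper_unif_continuous cdh e0.
pose s := d / (`|v| + 1).
have v0 : 0 < `|v| + 1 by rewrite ltr_wpDl.
have s0 : 0 < s by rewrite divr_gt0.
have sv : s * `|v| <= d.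
  by rewrite /s mulrAC ler_pdivrMr// ler_wpM2l ?ltW// ltrDl.
have dq x : `|h (x + s *: v) - h x - s * 'D_v h x| <= s * e.
  have der (t : R) : is_derive t 1 (fun t => h (x + t *: v)) ('D_v h (x + t *: v)).
    exact: is_derive_line.
  have [|c] := @MVT_segment _ (fun t => h (x + t *: v)) (fun t => 'D_v h (x + t *: v)) 0 s (ltW s0).
    apply: continuous_subspaceT => t.
    by have [/derivable1_diffP/differentiable_continuous] := der t.
  rewrite in_itv/= => /andP[c0 cs]; rewrite scale0r addr0 subr0 => ->.
  rewrite mulrC -mulrBr normrM gtr0_norm// ler_pM2l//; apply: H.
  by rewrite addrC addKr normrZ ger0_norm// (le_trans _ sv)// ler_wpM2r.
have chs : cper (fun x => h (x + s *: v)) by exact: cper_shift.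
have := normr_torus_integral_le (cperB (cperB chs ch) (cperZ s cdh)) dq.
rewrite torus_integralB ?torus_integralB ?torus_integral_shift ?subrr ?torus_integralZ//;
  [|exact: cperB|exact: cperZ].
by rewrite sub0r normrN normrM gtr0_norm// ler_pM2l.
Qed.

(** * Cosine waves *)

Definition dotv (R : realType) (N : nat) (n x : 'rV[R]_N) : R := \sum_i n 0 i * x 0 i.

Definition int_row (R : realType) (N : nat) (n : 'rV[R]_N) : Prop :=
  forall i, n 0 i \is a Num.int.

(** The phase closes the family under translation and, up to a factor, differentiation: a derivative
    adds [pi / 2]. The phase [- (pi / 2)] gives the sine. *)
Definition pcos (R : realType) (N : nat) (th : R) (n x : 'rV[R]_N) : R :=
  cos (th + 2 * pi * dotv n x).

Section dotv.
Context {R : realType} {N : nat}.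
Implicit Types (n m x y : 'rV[R]_N) (a : R).

Lemma dotvDr n x y : dotv n (x + y) = dotv n x + dotv n y.
Proof. by rewrite /dotv -big_split; apply: eq_bigr => i _; rewrite mxE mulrDr. Qed.

Lemma dotvDl n m x : dotv (n + m) x = dotv n x + dotv m x.
Proof. by rewrite /dotv -big_split; apply: eq_bigr => i _; rewrite mxE mulrDl. Qed.

Lemma dotvZr a n x : dotv n (a *: x) = a * dotv n x.
Proof. by rewrite /dotv mulr_sumr; apply: eq_bigr => i _; rewrite mxE mulrCA. Qed.

Lemma dotvNr n x : dotv n (- x) = - dotv n x.
Proof. by rewrite -scaleN1r dotvZr mulN1r. Qed.

Lemma dotvBr n x y : dotv n (x - y) = dotv n x - dotv n y.
Proof. by rewrite dotvDr dotvNr. Qed.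

Lemma dotvNl n x : dotv (- n) x = - dotv n x.
Proof. by rewrite /dotv -sumrN; apply: eq_bigr => i _; rewrite mxE mulNr. Qed.

Lemma dotv0l x : dotv 0 x = 0.
Proof. by rewrite /dotv big1// => i _; rewrite mxE mul0r. Qed.

Lemma dotv_delta n i : dotv n (delta_mx 0 i) = n 0 i.
Proof.
rewrite /dotv (bigD1 i)//= mxE !eqxx mulr1 big1 ?addr0// => j ji.
by rewrite mxE (negbTE ji) mulr0.
Qed.

Lemma dotv_delta_l n i : dotv (delta_mx 0 i) n = n 0 i.
Proof. by rewrite -[RHS]dotv_delta /dotv; apply: eq_bigr => j _; rewrite mulrC. Qed.

Lemma coord_rV_continuous (i : 'I_N) : continuous (fun x : 'rV[R]_N => x 0 i).
Proof. by move=> x; exact: coord_continuous. Qed.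

Lemma dotv_continuous n : continuous (dotv n).
Proof.
apply: continuous_of_modulus => e e0.
pose c := \sum_i `|n 0 i|.
have c0 : 0 < c + 1 by rewrite ltr_wpDl// sumr_ge0.
exists (e / (c + 1)); first by rewrite divr_gt0.
move=> x y xy; rewrite -dotvBr (le_trans (ler_norm_sum _ _ _))//.
apply: (@le_trans _ _ (\sum_i `|n 0 i| * (e / (c + 1)))).
  apply: ler_sum => i _; rewrite normrM ler_wpM2l//.
  by have /norm_rV_le := xy; apply; rewrite ltW// divr_gt0.
by rewrite -mulr_suml mulrCA ler_piMr ?(ltW e0)// ler_pdivrMr// mul1r lerDl.
Qed.

(** The row [a] represents [c] times the functional that reads off the coefficient of [n]. As a
    translation it moves the phase of one cosine and leaves the others alone. *)
Lemma free_dotv n (ns : seq 'rV[R]_N) : free (n :: ns) -> forall c : R,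
  exists a : 'rV[R]_N, dotv n a = c /\ forall m, m \in ns -> dotv m a = 0.
Proof.
move=> fr c; pose X := in_tuple (n :: ns).
pose i0 : 'I_(size (n :: ns)) := Ordinal (isT : 0 < size (n :: ns))%N.
pose a : 'rV[R]_N := \row_i (c * coord X i0 (delta_mx 0 i)).
have E m : dotv m a = c * coord X i0 m.
  rewrite [m in RHS]row_sum_delta linear_sum mulr_sumr; apply: eq_bigr => i _.
  by rewrite mxE linearZ/= mulrCA.
exists a; rewrite E; split.
  have -> : n = X`_i0 by [].
  by rewrite coord_free// eqxx mulr1.
move=> m /(nthP 0)[k kn <-].
have ks : (k.+1 < size (n :: ns))%N by [].
rewrite E; have -> : ns`_k = X`_(Ordinal ks) by [].
by rewrite coord_free// mulr0.
Qed.

End dotv.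

Lemma cosM (R : realType) (a b : R) : cos a * cos b = 2^-1 * cos (a + b) + 2^-1 * cos (a - b).
Proof. rewrite cosD cosB; lra. Qed.

Lemma cosD2pi_int (R : realType) (a z : R) : z \is a Num.int -> cos (a + 2 * pi * z) = cos a.
Proof.
have nat1 (m : nat) (b : R) : cos (b + 2 * pi * m%:R) = cos b.
  have -> : 2 * pi * m%:R = (pi : R) *+ 2 *+ m by rewrite !mulrnAl mulr_natr mul1r mulrnAC.
  exact: (periodicn (@cosD2pi R)).
move=> /intrP[[m|m] ->]; first exact: nat1.
by rewrite NegzE mulrNz -[LHS](nat1 m.+1) mulrN subrK.
Qed.

Lemma is_derive_from_line (R : realType) (V W : normedModType R) (f : V -> W) (x v : V) d :
  is_derive (0 : R) (1 : R) (fun h : R => f (h *: v + x)) d -> is_derive x v f d.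
Proof.
move=> H; have E : (fun h : R => h^-1 *: (f (h *: v + x) - f x)) =
   (fun h : R => h^-1 *: (f ((h *: (1 : R) + 0) *: v + x) - f (0 *: v + x))).
  by apply/funext => h; rewrite [h *: 1]mulr1 addr0 scale0r add0r.
by case: H => dH <-; apply: DeriveDef; rewrite /derivable /derive E.
Qed.

Section pcos.
Context {R : realType} {N : nat}.
Implicit Types (n m x y : 'rV[R]_N) (th : R).

Lemma pcosD th n x y : pcos th n (x + y) = pcos (th + 2 * pi * dotv n y) n x.
Proof. by rewrite /pcos dotvDr; congr cos; lra. Qed.

Lemma pcos_continuous th n : continuous (pcos th n).
Proof.
move=> x; apply: (@continuous_comp _ _ _ (fun x => th + 2 * pi * dotv n x) cos); last exact:
  continuous_cos.
apply: continuousD; first exact: cst_continuous.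
apply: (@continuousM R 'rV[R]_N (fun=> 2 * pi) (dotv n)); first exact: cst_continuous.
exact: dotv_continuous.
Qed.

Lemma cper_pcos th n : int_row n -> cper (pcos th n).
Proof.
move=> ni; split; first exact: pcos_continuous.
by move=> x i; rewrite pcosD dotv_delta /pcos addrAC (cosD2pi_int _ (ni i)).
Qed.

Lemma is_derive_pcos th n x v :
  is_derive x v (pcos th n) (2 * pi * dotv n v * pcos (th + pi / 2) n x).
Proof.
have H : is_derive (0 : R) (1 : R) (cos \o (fun h => h * (2 * pi * dotv n v) + (th +
  2 * pi * dotv n x)))
    (- sin (th + 2 * pi * dotv n x) * (2 * pi * dotv n v)).
  apply: is_derive1_comp; first by rewrite mul0r add0r; exact: is_derive_cos.
  set b := 2 * pi * dotv n v; rewrite -[X in is_derive _ _ _ X]addr0.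
  apply: is_deriveD.
  have := is_deriveM (is_derive_id (0 : R) (1 : R)) (is_derive_cst b (0 : R) (1 : R)).
  by rewrite scaler0 add0r [_ *: _]mulr1.
have E : (fun h : R => pcos th n (h *: v + x)) =
    (cos \o (fun h => h * (2 * pi * dotv n v) + (th + 2 * pi * dotv n x))).
  by apply/funext => h; rewrite /pcos/= dotvDr dotvZr; congr cos; lra.
apply: is_derive_from_line; rewrite E.
by move: H; rewrite -cosDpihalf [_ + pi / 2]addrAC [_ * (2 * pi * _)]mulrC.
Qed.

Lemma cper_prod_pcos (s : seq (R * 'rV[R]_N)) : (forall q, q \in s -> int_row q.2) ->
  cper (fun x => \prod_(q <- s) pcos q.1 q.2 x).
Proof.
elim: s => [|q s IH] si.
  by under [X in cper X]funext do rewrite big_nil; exact: cper_cst.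
under [X in cper X]funext do rewrite big_cons.
apply: cperM; first by apply/cper_pcos/si; rewrite mem_head.
by apply: IH => p ps; apply: si; rewrite inE ps orbT.
Qed.

Lemma torus_integral_prod_pcos_free (q : R * 'rV[R]_N) (s : seq (R * 'rV[R]_N)) :
  (forall p, p \in q :: s -> int_row p.2) -> free [seq p.2 | p <- q :: s] ->
  torus_integral (fun x => \prod_(p <- q :: s) pcos p.1 p.2 x) = 0.
Proof.
move=> si fr.
(* A shift by one half of a period, [2 * pi * 2^-1 = pi], flips the sign of the first cosine. *)
have [a [qa sa]] := free_dotv fr 2^-1.
have cf := cper_prod_pcos si.
have : torus_integral (fun x => \prod_(p <- q :: s) pcos p.1 p.2 x) =
   -1 * torus_integral (fun x => \prod_(p <- q :: s) pcos p.1 p.2 x).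
  rewrite -{1}(torus_integral_shift a cf) -torus_integralZ//; congr torus_integral.
  apply/funext => x; rewrite !big_cons pcosD qa mulrA; congr (_ * _).
    rewrite mulN1r /pcos mulrAC divff// mul1r addrAC cosDpi.
    by [].
  rewrite !big_seq; apply: eq_bigr => p ps.
  by rewrite pcosD sa ?mulr0 ?addr0//; exact: map_f.
lra.
Qed.

Lemma torus_integral_pcos th n : int_row n -> n != 0 -> torus_integral (pcos th n) = 0.
Proof.
move=> ni n0; have := @torus_integral_prod_pcos_free (th, n) [::].
rewrite /= seq1_free; under [X in torus_integral X]funext do rewrite big_seq1.
by apply=> // p; rewrite inE => /eqP ->.
Qed.

Lemma torus_integral_pcos00 : torus_integral (pcos 0 (0 : 'rV[R]_N)) = 1.
Proof.
rewrite -[RHS](@torus_integral_cst R N); congr torus_integral.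
by apply/funext => x; rewrite /pcos dotv0l mulr0 addr0 cos0.
Qed.

(** Multiplying [pcos 0 m] with the first factor gives half the sum of the cosines of [m + n] and
    [m - n]. Both means are nonnegative by induction, and if [m] is the sum of the whole list then
    [m - n] is the sum of the rest. *)
Lemma torus_integral_prod_pcos0 m (s : seq 'rV[R]_N) :
  int_row m -> (forall n, n \in s -> int_row n) ->
  let I := torus_integral (fun x => pcos 0 m x * \prod_(n <- s) pcos 0 n x) in
  0 <= I /\ (m = \sum_(n <- s) n -> 0 < I).
Proof.
elim: s m => [|n s IH] m mi si /=.
  under [X in torus_integral X]funext do rewrite big_nil mulr1.
  rewrite big_nil; have [->|m0] := eqVneq m 0; first by rewrite torus_integral_pcos00.
  by rewrite torus_integral_pcos//; split => // /eqP; rewrite (negbTE m0).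
have ni : int_row n by apply: si; rewrite mem_head.
have si' k : k \in s -> int_row k by move=> ks; apply: si; rewrite inE ks orbT.
have pi' k : int_row k -> cper (fun x => pcos 0 k x * \prod_(n <- s) pcos 0 n x).
  move=> ki; apply: cperM; first exact: cper_pcos.
  have := @cper_prod_pcos [seq (0, n) | n <- s].
  under [X in cper X]funext do rewrite big_map /=.
  by apply=> q /mapP[p ps ->]; exact: si'.
have Di : int_row (m + n) by move=> i; rewrite mxE rpredD.
have Bi : int_row (m - n) by move=> i; rewrite !mxE rpredB.
have -> : (fun x => pcos 0 m x * \prod_(j <- n :: s) pcos 0 j x) =
  (fun x => 2^-1 * (pcos 0 (m + n) x * \prod_(j <- s) pcos 0 j x) +
            2^-1 * (pcos 0 (m - n) x * \prod_(j <- s) pcos 0 j x)).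
  apply/funext => x; rewrite big_cons mulrA /pcos cosM !mulrA -mulrDl.
  by rewrite dotvDl dotvDl dotvNl; congr ((_ * cos _ + _ * cos _) * _); lra.
rewrite torus_integralD; [|exact/cperZ/pi'|exact/cperZ/pi'].
rewrite !torus_integralZ; [|exact: pi'|exact: pi'].
have [D0 _] := IH _ Di si'; have [B0 B1] := IH _ Bi si'.
split; first by rewrite addr_ge0// mulr_ge0.
rewrite big_cons => mE; rewrite ltr_wpDl//; first by rewrite mulr_ge0.
by rewrite mulr_gt0// B1// mE addrC addKr.
Qed.

End pcos.

(** * Vector-valued fields and sums of waves *)

Lemma is_derive_row (R : realType) (V : normedModType R) d (f : V -> 'rV[R]_d) x v (D : 'rV[R]_d) :
  (forall j, is_derive x v (fun y => f y 0 j) (D 0 j)) -> is_derive x v f D.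
Proof.
move=> H; have df : derivable f x v.
  by apply/derivable_mxP => i j; rewrite ord1; case: (H j).
apply: DeriveDef => //; rewrite derive_mx//.
by apply/rowP => j; rewrite mxE; case: (H j).
Qed.

Lemma is_derive_coord (R : realType) (V : normedModType R) d (f : V -> 'rV[R]_d) x v (D :
  'rV[R]_d) j :
  is_derive x v f D -> is_derive x v (fun y => f y 0 j) (D 0 j).
Proof.
move=> [df <-]; rewrite derive_mx// mxE; apply: derivableP.
by move/derivable_mxP : df.
Qed.

Lemma continuous_row (R : realType) (V : normedModType R) d (f : V -> 'rV[R]_d) :
  (forall j, continuous (fun y => f y 0 j)) -> continuous f.
Proof.
move=> H x; apply/cvgrPdist_le => e e0; near=> y.
apply/norm_rV_le; first exact: ltW.
move=> j; rewrite !mxE; move: j; near: y; apply: filter_forall => j.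
by have /cvgrPdist_le := H j x; apply.
Unshelve. all: by end_near. Qed.

Lemma continuous_coord (R : realType) (V : normedModType R) d (f : V -> 'rV[R]_d) j :
  continuous f -> continuous (fun y => f y 0 j).
Proof.
move=> cf x; apply: (@continuous_comp _ _ _ f (fun z : 'rV[R]_d => z 0 j)); first exact: cf.
exact: coord_rV_continuous.
Qed.

Lemma continuous_addf (R : realType) (T : topologicalType) (f g : T -> R) :
  continuous f -> continuous g -> continuous (fun x => f x + g x).
Proof. by move=> fc gc x; apply: continuousD; [exact: fc|exact: gc]. Qed.

Lemma continuous_mulf (R : realType) (T : topologicalType) (f g : T -> R) :
  continuous f -> continuous g -> continuous (fun x => f x * g x).
Proof. by move=> fc gc x; apply: continuousM; [exact: fc|exact: gc]. Qed.

(** Amplitude, then phase, then frequency. *)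
Definition wave (R : realType) (N d : nat) : Type := 'rV[R]_d * (R * 'rV[R]_N).

Section waves.
Context {R : realType} {N d : nat}.
Implicit Types (q : wave R N d) (L : seq (wave R N d)).

Definition waves L (x : 'rV[R]_N) : 'rV[R]_d := \sum_(q <- L) pcos q.2.1 q.2.2 x *: q.1.

(** The effect of [m] partial derivatives: a factor [c] depending on the frequency, and [m] quarter
    turns of the phase. *)
Definition scale_wave (c : 'rV[R]_N -> R) (m : nat) q : wave R N d :=
  (c q.2.2 *: q.1, (q.2.1 + m%:R * (pi / 2), q.2.2)).

Lemma scale_wave_comp c c' m m' : scale_wave c m \o scale_wave c' m' =
  scale_wave (fun n => c n * c' n) (m + m').
Proof.
apply/funext => q; rewrite /scale_wave /= scalerA.
by congr (_, (_, _)); rewrite natrD; ring.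
Qed.

Lemma wavesE L x j : waves L x 0 j = \sum_(q <- L) q.1 0 j * pcos q.2.1 q.2.2 x.
Proof. by rewrite /waves summxE; apply: eq_bigr => q _; rewrite mxE mulrC. Qed.

Lemma waves_continuous L : continuous (waves L).
Proof.
apply: continuous_row => j; under [X in continuous X]funext do rewrite wavesE.
elim: L => [|q L IH].
  by under [X in continuous X]funext do rewrite big_nil; exact: cst_continuous.
under [X in continuous X]funext do rewrite big_cons.
apply: continuous_addf; last exact: IH.
by apply: continuous_mulf; [exact: cst_continuous|exact: pcos_continuous].
Qed.

Lemma waves_periodic L : (forall q, q \in L -> int_row q.2.2) -> unit_periodic (waves L).
Proof.
move=> Li x i; rewrite /waves !big_seq; apply: eq_bigr => q qL.
by rewrite (cper_pcos _ (Li _ qL)).2.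
Qed.

Lemma is_derive_waves L x i : is_derive x (delta_mx 0 i : 'rV[R]_N) (waves L)
  (waves [seq scale_wave (fun n => 2 * pi * n 0 i) 1 q | q <- L] x).
Proof.
apply: is_derive_row => j; under [X in is_derive _ _ X _]funext do rewrite wavesE.
rewrite wavesE big_map; elim: L => [|q L IH].
  by under [X in is_derive _ _ X _]funext do rewrite big_nil; rewrite big_nil; exact: is_derive_cst.
under [X in is_derive _ _ X _]funext do rewrite big_cons.
rewrite big_cons; apply: is_deriveD.
apply: is_derive_eq.
  exact: (is_deriveZ (q.1 0 j) (is_derive_pcos q.2.1 q.2.2 x (delta_mx 0 i))).
by rewrite /= mxE mul1r dotv_delta /GRing.scale /=; ring.
Qed.

Lemma partial_waves L i :
  partial i (waves L) = waves [seq scale_wave (fun n => 2 * pi * n 0 i) 1 q | q <- L].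
Proof. by apply/funext => x; have [_ H] := is_derive_waves L x i. Qed.

Lemma smooth_waves L : smooth (waves L).
Proof.
move=> s; have [L' ->] : exists L', foldr (@partial R N d) (waves L) s = waves L'.
  elim: s => [|i s [L' IH]]; first by exists L.
  by rewrite /= IH partial_waves; eexists.
split; first exact: waves_continuous.
by move=> i x; have [H _] := is_derive_waves L' x i.
Qed.

Lemma iter_partial_waves m L i : iter m (partial i) (waves L) =
  waves [seq scale_wave (fun n => (2 * pi * n 0 i) ^+ m) m q | q <- L].
Proof.
elim: m => [|m IH].
  rewrite /=; congr waves; rewrite -[LHS]map_id; apply: eq_map => -[u [th n]].
  by rewrite /scale_wave/= expr0 scale1r mul0r addr0.
rewrite iterS IH partial_waves -map_comp scale_wave_comp.
by congr waves; apply: eq_map => q; congr scale_wave; apply/funext => n; rewrite exprS.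
Qed.

Lemma partial_multi_waves k (alpha : multi_index N k) L : partial_multi alpha (waves L) =
  waves [seq scale_wave (fun n => (2 * pi) ^+ k * \prod_(i < N) n 0 i ^+ val alpha i) k q | q <- L].
Proof.
rewrite /partial_multi.
have -> s : foldr (fun i f => iter (val alpha i) (partial i) f) (waves L) s =
  waves [seq scale_wave (fun n => \prod_(i <- s) (2 * pi * n 0 i) ^+ val alpha i)
           (\sum_(i <- s) val alpha i) q | q <- L].
  elim: s => [|i s IH] /=.
    congr waves; rewrite -[LHS]map_id; apply: eq_map => -[u [th n]].
    by rewrite /scale_wave/= !big_nil scale1r mul0r addr0.
  rewrite IH iter_partial_waves -map_comp scale_wave_comp big_cons.
  by congr waves; apply: eq_map => q; congr scale_wave; apply/funext => n; rewrite big_cons.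
have sk : (\sum_(i < N) val alpha i)%N = k by apply/eqP; exact: (valP alpha).
rewrite !big_enum /= sk; congr waves; apply: eq_map => q; congr scale_wave.
apply/funext => n; rewrite big_enum /= -[X in _ ^+ X]sk -prodrXr -big_split /=.
by apply: eq_bigr => i _; rewrite exprMn.
Qed.

(** All terms of a homogeneous operator turn the phase by the same [k] quarter turns, so the wave
    [(u, (th, n))] is sent to one cosine times [(2 * pi) ^+ k *: (u *m symbol A n)]. *)
Lemma apply_op_waves l k (A : hdiffop R N d l k) L :
  (forall q, q \in L -> q.1 *m symbol A q.2.2 = 0) -> forall x, apply_op A (waves L) x = 0.
Proof.
move=> LA x; rewrite /apply_op.
under eq_bigr do rewrite partial_multi_waves /waves big_map mulmx_suml.
rewrite exchange_big /= big_seq big1// => q qL.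
transitivity (pcos (q.2.1 + k%:R * (pi / 2)) q.2.2 x *: ((2 * pi) ^+ k *: (q.1 *m symbol A q.2.2))).
  rewrite /symbol mulmx_sumr !scaler_sumr; apply: eq_bigr => al _.
  by rewrite -!scalemxAl -scalemxAr !scalerA mulrA.
by rewrite LA// !scaler0.
Qed.

End waves.

(** * Fourier coefficients of smooth periodic fields *)

Section fourier_coefficient.
Context {R : realType} {N d : nat}.
Implicit Types (u : 'rV[R]_N -> 'rV[R]_d).

Lemma smooth_continuous u : smooth u -> continuous u.
Proof. by move=> /(_ [::])[]. Qed.

Lemma smooth_partial u i : smooth u -> smooth (partial i u).
Proof. by move=> su s; have := su (rcons s i); rewrite foldr_rcons. Qed.

Lemma periodic_partial u i : unit_periodic u -> unit_periodic (partial i u).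
Proof.
move=> pu x j; pose v : 'rV[R]_N := delta_mx 0 i.
have E : (fun h : R => h^-1 *: (u (h *: v + (x + delta_mx 0 j)) - u (x + delta_mx 0 j))) =
    (fun h : R => h^-1 *: (u (h *: v + x) - u x)).
  by apply/funext => h /=; rewrite addrA !pu.
by rewrite /partial /derive E.
Qed.

Lemma cper_coord u j : continuous u -> unit_periodic u -> cper (fun x => u x 0 j).
Proof.
by move=> su pu; split=> [|x i]; [exact: continuous_coord|rewrite pu].
Qed.

(** Integration by parts. The minus sign is absorbed by lowering the phase by [pi / 2] instead of
    raising it. *)
Lemma torus_integral_partial u i j th (n : 'rV[R]_N) :
  smooth u -> unit_periodic u -> int_row n ->
  torus_integral (fun x => partial i u x 0 j * pcos th n x) =
  2 * pi * n 0 i * torus_integral (fun x => u x 0 j * pcos (th - pi / 2) n x).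
Proof.
move=> su pu ni.
have cu : cper (fun x => u x 0 j) by apply: cper_coord => //; exact: smooth_continuous.
have cdu : cper (fun x => partial i u x 0 j).
  by apply: cper_coord; [exact/smooth_continuous/smooth_partial|exact: periodic_partial].
have cp t := cper_pcos t ni.
have D x : is_derive x (delta_mx 0 i) (fun x => u x 0 j * pcos th n x)
   (partial i u x 0 j * pcos th n x - 2 * pi * n 0 i * (u x 0 j * pcos (th - pi / 2) n x)).
  have d1 : is_derive x (delta_mx 0 i) (fun y => u y 0 j) (partial i u x 0 j).
    by apply: is_derive_coord; apply: derivableP; have [_] := su [::]; exact.
  apply: is_derive_eq; first exact: (is_deriveM d1 (is_derive_pcos th n x (delta_mx 0 i))).
  rewrite dotv_delta [_ *: _]mulrC [X in _ + X]mulrC.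
  have -> : pcos (th + pi / 2) n x = - pcos (th - pi / 2) n x.
    by rewrite /pcos -[RHS]cosDpi; congr cos; lra.
  rewrite /GRing.scale /=; lra.
apply/eqP; rewrite -subr_eq0 -torus_integralZ; last exact: cperM.
rewrite -torus_integralB; [|exact: cperM|exact/cperZ/cperM].
have E : (fun x => 'D_(delta_mx 0 i) (fun x => u x 0 j * pcos th n x) x) =
  (fun x => partial i u x 0 j * pcos th n x - 2 * pi * n 0 i * (u x 0 j * pcos (th - pi / 2) n x)).
  by apply/funext => x; case: (D x).
rewrite -E; apply/eqP/torus_integral_derive0; first exact: cperM.
  by move=> x; case: (D x).
by rewrite E; apply: cperB; [exact: cperM|exact/cperZ/cperM].
Qed.

Lemma torus_integral_partial_multi k (alpha : multi_index N k) u j th (n : 'rV[R]_N) :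
  smooth u -> unit_periodic u -> int_row n ->
  torus_integral (fun x => partial_multi alpha u x 0 j * pcos th n x) =
  (2 * pi) ^+ k * \prod_(i < N) n 0 i ^+ val alpha i *
  torus_integral (fun x => u x 0 j * pcos (th - k%:R * (pi / 2)) n x).
Proof.
move=> su pu ni.
have it m i v th' : smooth v -> unit_periodic v ->
  [/\ smooth (iter m (partial i) v), unit_periodic (iter m (partial i) v) &
  torus_integral (fun x => iter m (partial i) v x 0 j * pcos th' n x) =
  (2 * pi * n 0 i) ^+ m * torus_integral (fun x => v x 0 j * pcos (th' - m%:R * (pi / 2)) n x)].
  move=> sv pv; elim: m th' => [|m IH] th'; first by rewrite expr0 mul1r mul0r subr0.
  have [s1 p1 _] := IH 0; split; [exact: smooth_partial|exact: periodic_partial|].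
  rewrite iterS torus_integral_partial//; have [_ _ ->] := IH (th' - pi / 2).
  rewrite mulrA exprS; congr (_ * torus_integral _); apply/funext => x.
  by congr (_ * pcos _ _ _); rewrite -[m.+1%:R]natr1; ring.
pose F s := foldr (fun i f => iter (val alpha i) (partial i) f) u s.
have sF s : smooth (F s) /\ unit_periodic (F s).
  elim: s => [|i s [s1 p1]]; first by split.
  by have [s2 p2 _] := it (val alpha i) i (F s) 0 s1 p1; split.
have E s th' : torus_integral (fun x => F s x 0 j * pcos th' n x) =
  \prod_(i <- s) (2 * pi * n 0 i) ^+ val alpha i *
  torus_integral (fun x => u x 0 j * pcos (th' - (\sum_(i <- s) val alpha i)%:R * (pi / 2)) n x).
  elim: s th' => [|i s IH] th' /=; first by rewrite !big_nil mul1r mul0r subr0.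
  have [_ _ ->] := it (val alpha i) i (F s) th' (sF s).1 (sF s).2.
  rewrite IH !big_cons mulrA; congr (_ * torus_integral _); apply/funext => x.
  by congr (_ * pcos _ _ _); rewrite natrD; ring.
have sk : (\sum_(i < N) val alpha i)%N = k by apply/eqP; exact: (valP alpha).
rewrite [LHS]E !big_enum /= sk; congr (_ * _).
rewrite -[X in _ = _ ^+ X * _]sk -prodrXr -big_split /=.
by apply: eq_bigr => i _; rewrite exprMn.
Qed.

Lemma fourier_coef_ker l k (A : hdiffop R N d l k) u th (n : 'rV[R]_N) :
  smooth u -> unit_periodic u -> int_row n -> (forall x, apply_op A u x = 0) ->
  (\row_j torus_integral (fun x => u x 0 j * pcos th n x)) *m symbol A n = 0.
Proof.
move=> su pu ni Au.
set b := \row_j _.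
have sF (alpha : multi_index N k) : smooth (partial_multi alpha u) /\ unit_periodic
  (partial_multi alpha u).
  rewrite /partial_multi; elim: (enum _) => [//|i s [s1 p1]] /=.
  elim: (val alpha i : nat) => [//|m [s2 p2]] /=.
  by split; [exact: smooth_partial|exact: periodic_partial].
have cF (alpha : multi_index N k) j t : cper (fun x => partial_multi alpha u x 0 j * pcos t n x).
  apply: cperM; last exact: cper_pcos.
  by have [s1 p1] := sF alpha; apply: cper_coord => //; exact: smooth_continuous.
suff : (2 * pi) ^+ k *: (b *m symbol A n) = 0.
  by move/eqP; rewrite scaler_eq0 expf_eq0 mulf_eq0 (gt_eqF (pi_gt0 R)) pnatr_eq0 andbF => /eqP.
apply/rowP => c.
(* The equation is tested against a cosine advanced by [k] quarter turns, which the [k] integrations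
   by parts take back to the phase [th]. *)
transitivity (torus_integral (fun x => apply_op A u x 0 c * pcos (th + k%:R * (pi / 2)) n x));
  last first.
  under [X in torus_integral X]funext do rewrite Au mxE mul0r.
  by rewrite torus_integral_cst mxE.
transitivity (torus_integral (fun x => \sum_(alpha : multi_index N k) \sum_j
    A alpha j c * (partial_multi alpha u x 0 j * pcos (th + k%:R * (pi / 2)) n x))); last first.
  congr torus_integral; apply/funext => x; rewrite /apply_op summxE mulr_suml.
  apply: eq_bigr => al _; rewrite mxE mulr_suml; apply: eq_bigr => j _.
  by rewrite mulrAC mulrC.
rewrite torus_integral_sum; last by move=> al; apply: cper_sum => j; exact: cperZ.
rewrite /symbol mulmx_sumr scaler_sumr summxE; apply: eq_bigr => al _.
rewrite torus_integral_sum; last by move=> j; exact: cperZ.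
rewrite -scalemxAr scalerA !mxE mulr_sumr; apply: eq_bigr => j _.
rewrite torus_integralZ// torus_integral_partial_multi// addrK mxE.
by rewrite [RHS]mulrC mulrA.
Qed.

End fourier_coefficient.

(** * A trigonometric kernel *)

Section kernel.
Context {R : realType} {N : nat}.
Implicit Types (s : seq 'I_N) (x y : 'rV[R]_N) (i : 'I_N).

Let c i := pcos 0 (delta_mx 0 i : 'rV[R]_N).
Let sn i := pcos (- (pi / 2)) (delta_mx 0 i : 'rV[R]_N).

(** The exponent of [1 + cos (2 pi x_i)] is the multiplicity of [i] in [s]; the list form allows
    inductions that add one factor at a time. *)
Definition trig_kernel s x : R := \prod_(i <- s) (1 + pcos 0 (delta_mx 0 i) x).

Lemma int_row_delta i : int_row (delta_mx 0 i : 'rV[R]_N).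
Proof. by move=> j; rewrite mxE; case: (_ && _). Qed.

Lemma cper_trig_kernel s : cper (trig_kernel s).
Proof.
apply: cper_prod => i; apply: cperD; first exact: cper_cst.
exact/cper_pcos/int_row_delta.
Qed.

Let cper_c i : cper (c i).
Proof. exact/cper_pcos/int_row_delta. Qed.

Let cper_1c i : cper (fun x => 1 - c i x).
Proof. by apply: cperB => //; exact: cper_cst. Qed.

Lemma trig_kernel_ge0 s x : 0 <= trig_kernel s x.
Proof.
apply: prodr_ge0 => i _; rewrite -lerBlDl sub0r; exact: cos_geN1.
Qed.

Let sncE i x : sn i x ^+ 2 = (1 - c i x) * (1 + c i x).
Proof.
rewrite /sn /c /pcos add0r addrC cosBpihalf sin2cos2; ring.
Qed.

(** This finite expansion is what turns a convolution with the kernel into a finite sum of waves. *)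
Lemma trig_kernel_cos_sum s : exists T : seq (R * 'rV[R]_N),
  (forall t, t \in T -> int_row t.2) /\
  forall x, trig_kernel s x = \sum_(t <- T) t.1 * pcos 0 t.2 x.
Proof.
elim: s => [|i s [T [Ti TE]]].
  exists [:: (1, 0)]; split=> [t|x].
    by rewrite inE => /eqP -> j; rewrite mxE.
  by rewrite /trig_kernel big_nil big_seq1 /pcos dotv0l mulr0 addr0 cos0 mulr1.
exists (T ++ [seq (2^-1 * t.1, t.2 + delta_mx 0 i) | t <- T]
          ++ [seq (2^-1 * t.1, t.2 - delta_mx 0 i) | t <- T]); split.
  move=> t; rewrite !mem_cat => /or3P[/Ti//|/mapP[t' /Ti t'i ->]|/mapP[t' /Ti t'i ->]] j;
  by rewrite /= !mxE ?(rpredB, rpredD)// ?t'i//; have := int_row_delta i j; rewrite !mxE.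
move=> x; rewrite /trig_kernel big_cons -/(trig_kernel s x) TE mulrDl mul1r mulr_sumr.
rewrite !big_cat /= !big_map; congr (_ + _); rewrite -big_split; apply: eq_bigr => t _ /=.
rewrite mulrCA [pcos _ _ _ * _]mulrC /pcos cosM dotvDl dotvDl dotvNl.
rewrite mulrDr !mulrA [t.1 / 2]mulrC.
by congr (_ * cos _ + _ * cos _); ring.
Qed.

(** Differentiating a factor [1 + c i x] removes it and leaves a sine; multiplying by [sn i x]
    restores it, since the squared sine is [(1 - c i x) * (1 + c i x)]. In this form no division by
    the factor is needed. *)
Lemma is_derive_trig_kernel s i x : exists2 D,
  is_derive x (delta_mx 0 i : 'rV[R]_N) (trig_kernel s) D &
  D * sn i x = - (2 * pi * (count_mem i s)%:R * (1 - c i x) * trig_kernel s x).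
Proof.
elim: s => [|j s [D dD DE]].
  exists 0; last by rewrite /= mul0r mulr0 !mul0r oppr0.
  rewrite (_ : trig_kernel [::] = cst 1); first exact: is_derive_cst.
  by apply/funext => y; rewrite /trig_kernel big_nil.
pose E := 2 * pi * dotv (delta_mx 0 j : 'rV[R]_N) (delta_mx 0 i) * pcos (0 +
  pi / 2) (delta_mx 0 j) x.
have d1 : is_derive x (delta_mx 0 i : 'rV[R]_N) (fun y => 1 + c j y) (0 + E).
  by apply: is_deriveD; exact: is_derive_pcos.
exists ((1 + c j x) * D + trig_kernel s x * (0 + E)).
  have -> : trig_kernel (j :: s) = (fun y => (1 + c j y) * trig_kernel s y).
    by apply/funext => y; rewrite /trig_kernel big_cons.
  exact: (is_deriveM d1 dD).
have -> : trig_kernel (j :: s) x = (1 + c j x) * trig_kernel s x by rewrite /trig_kernel big_cons.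
have -> : E = - (2 * pi * (j == i)%:R * sn j x).
  rewrite /E dotv_delta mxE eqxx /= /sn /pcos eq_sym add0r [pi / 2 + _]addrC cosDpihalf.
  by rewrite [- (pi / 2) + _]addrC cosBpihalf; ring.
have -> : ((1 + c j x) * D + trig_kernel s x * (0 + - (2 * pi * (j == i)%:R * sn j x))) * sn i x =
  (1 + c j x) * (D * sn i x) - trig_kernel s x * (2 * pi * (j == i)%:R * (sn j x * sn i x)) by ring.
rewrite DE /= natrD; case: eqP => [->|_] /=; last by ring.
by rewrite -expr2 sncE; ring.
Qed.

(* Integrate the derivative of [kernel * sin (2 pi x_i)] over the torus. *)
Lemma torus_integral_trig_kernel_moment s i :
  torus_integral (fun x => trig_kernel s x * (1 - c i x)) =
  torus_integral (trig_kernel s) / (count_mem i s).+1%:R.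
Proof.
set m := count_mem i s.
have cK := cper_trig_kernel s.
have csn : cper (sn i) by exact/cper_pcos/int_row_delta.
have D x : is_derive x (delta_mx 0 i : 'rV[R]_N) (fun x => trig_kernel s x * sn i x)
    (2 * pi * (trig_kernel s x - m.+1%:R * (trig_kernel s x * (1 - c i x)))).
  have [D dD DE] := is_derive_trig_kernel s i x.
  apply: is_derive_eq; first exact: (is_deriveM dD (is_derive_pcos _ _ _ _)).
  rewrite dotv_delta mxE !eqxx mulr1 addNr -/(c i) /GRing.scale /= -/(sn i x).
  by rewrite [sn i x * D]mulrC DE -/m -natr1; ring.
have E : (fun x => 'D_(delta_mx 0 i) (fun x => trig_kernel s x * sn i x) x) =
    (fun x => 2 * pi * (trig_kernel s x - m.+1%:R * (trig_kernel s x * (1 - c i x)))).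
  by apply/funext => x; case: (D x).
have cE : cper (fun x => 2 * pi * (trig_kernel s x - m.+1%:R * (trig_kernel s x * (1 - c i x)))).
  by apply/cperZ/cperB => //; apply/cperZ/cperM.
have I0 : torus_integral (fun x => 'D_(delta_mx 0 i) (fun x => trig_kernel s x * sn i x) x) = 0.
  apply: torus_integral_derive0; [exact: cperM|by move=> x; case: (D x)|by rewrite E].
move: I0; rewrite E torus_integralZ; last by apply/cperB => //; apply/cperZ/cperM.
rewrite torus_integralB//; last by apply/cperZ/cperM.
rewrite torus_integralZ; last exact: cperM.
move/eqP; rewrite !mulf_eq0 pnatr_eq0 (gt_eqF (pi_gt0 R)) /= subr_eq0 => /eqP ->.
by rewrite mulrAC divff ?mul1r// pnatr_eq0.
Qed.

(** Since [1 + c i x = 2 - (1 - c i x)], the moment formula shows that a new factor multiplies the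
    mean by [2 - 1 / (count_mem i s).+1%:R], which is at least 1. *)
Lemma torus_integral_trig_kernel_gt0 s : 0 < torus_integral (trig_kernel s).
Proof.
elim: s => [|i s IH].
  rewrite (_ : trig_kernel [::] = (fun=> 1)); first by rewrite torus_integral_cst.
  by apply/funext => x; rewrite /trig_kernel big_nil.
have cK := cper_trig_kernel s.
have -> : trig_kernel (i :: s) = (fun x => 2 * trig_kernel s x - trig_kernel s x * (1 - c i x)).
  by apply/funext => x; rewrite /trig_kernel big_cons /c; ring.
rewrite torus_integralB ?torus_integralZ//; [|exact: cperZ|exact: cperM].
rewrite torus_integral_trig_kernel_moment subr_gt0 ltr_pdivrMr ?ltr0n//.
rewrite mulrAC ltr_pMl//.
have : (1 : R) <= (count_mem i s).+1%:R by rewrite ler1n.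
lra.
Qed.

Lemma cper_bounded (f : 'rV[R]_N -> R) : cper f -> exists B, forall x, `|f x| <= B.
Proof.
move=> cf; pose K := [set v : 'rV[R]_N | forall i, v ord0 i \in `[0%R, 1%R]%R].
have cK : compact K.
  by apply: (@rV_compact R N (fun=> `[0%R, 1%R]%classic)) => _; exact: segment_compact.
have [c1 c2] := cper_norm cf.
have K0 : K !=set0 by exists 0 => i; rewrite mxE in_itv/= lexx ler01.
have [b _ Hb] := EVT_max_rV K0 cK (continuous_subspaceT c1).
exists `|f b| => x.
pose z : 'rV[R]_N := \row_i - (Num.floor (x 0 i))%:~R.
have zi i : z 0 i \is a Num.int by rewrite mxE rpredN intr_int.
rewrite -(periodic_int_shift c2 zi x); apply: Hb; rewrite inE => i; rewrite !mxE in_itv/=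
  subr_ge0 ge_floor/= lerBlDl.
by have /andP[_ /ltW] := floor_itv (x 0 i); rewrite intrD.
Qed.

(** If [y - x] is close to an integer vector, uniform continuity gives [e]. Otherwise some
    coordinate stays at distance more than [d'] from the integers, its term [1 - c i (y - x)] is at
    least [g], and [C = 2 * B / g] covers the largest possible oscillation of [f]. *)
Lemma cper_cos_modulus (f : 'rV[R]_N -> R) e : cper f -> 0 < e ->
  exists2 C, 0 <= C & forall x y, `|f y - f x| <= e + C * \sum_i (1 - c i (y - x)).
Proof.
move=> cf e0; have [B fB] := cper_bounded cf.
have B0 : 0 <= B by exact: le_trans (fB 0).
have [d d0 H] := cper_unif_continuous cf e0.
(* The cap [2^-1] keeps the angle [2 * pi * d'] in [[0, pi]], where the cosine decreases. *)
pose d' := Num.min d (2^-1).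
have d'0 : 0 < d' by rewrite lt_min d0 invr_gt0 ltr0n.
have d'2 : d' <= 2^-1 by rewrite ge_min lexx orbT.
have pi0 := pi_gt0 R.
have memb (a : R) : 0 <= a -> a <= 2^-1 -> 2 * pi * a \in `[0, pi]%R.
  move=> a0 a2; rewrite in_itv/= !mulr_ge0 ?(ltW pi0)//=.
  have := ler_wpM2l (ltW pi0) a2; lra.
have mono (a : R) : d' <= a -> a <= 2^-1 -> cos (2 * pi * a) <= cos (2 * pi * d').
  move=> da a2; rewrite leNgt ltr_cos; [|exact: (memb _ (le_trans (ltW d'0) da) a2)|exact:
    (memb _ (ltW d'0) d'2)].
  by rewrite -leNgt ler_pM2l// mulr_gt0.
pose g := 1 - cos (2 * pi * d').
have g0 : 0 < g.
  rewrite subr_gt0 -[ltRHS](@cos0 R) ltr_cos; [| |exact: (memb _ (ltW d'0) d'2)].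
    by rewrite mulr_gt0// mulr_gt0.
  by rewrite in_itv/= lexx ltW.
exists (2 * B / g); first by rewrite divr_ge0 ?mulr_ge0// ltW.
move=> x y.
have term0 i : 0 <= 1 - c i (y - x) by rewrite subr_ge0; exact: cos_le1.
(* Subtracts from each coordinate of [y - x] a nearest integer. *)
pose z : 'rV[R]_N := \row_i - (Num.floor ((y - x) 0 i + 2^-1))%:~R.
have zi i : z 0 i \is a Num.int by rewrite mxE rpredN intr_int.
have tle i : `|(y + z - x) 0 i| <= 2^-1.
  have /andP[h1 h2] := floor_itv ((y - x) 0 i + 2^-1); move: h1 h2.
  rewrite !mxE intrD => h1 h2; rewrite ler_norml; apply/andP; split; lra.
have [/forallP small|] := boolP [forall i, `|(y + z - x) 0 i| <= d'].
  rewrite -(periodic_int_shift cf.2 zi y); apply: (@le_trans _ _ e); last first.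
    by rewrite lerDl mulr_ge0 ?sumr_ge0// divr_ge0 ?mulr_ge0// ltW.
  apply/H/norm_rV_le => [|i]; first exact: ltW.
  by rewrite (le_trans (small i))// ge_min lexx.
rewrite negb_forall => /existsP[i]; rewrite -ltNge => ibig.
apply: (@le_trans _ _ (2 * B)).
  by rewrite (le_trans (ler_normB _ _))// mulr_natl mulr2n lerD.
rewrite -[leLHS]add0r lerD ?(ltW e0)// mulrAC ler_pdivlMr// ler_wpM2l ?mulr_ge0//.
rewrite (bigD1 i)//= -[leLHS]addr0 lerD ?sumr_ge0//.
rewrite /g lerD2l lerN2 /c /pcos add0r dotv_delta_l.
have -> : cos (2 * pi * (y - x) 0 i) = cos (2 * pi * `|(y + z - x) 0 i|).
  rewrite -[LHS](cosD2pi_int _ (zi i)) -mulrDr.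
  have -> : (y - x) 0 i + z 0 i = (y + z - x) 0 i by rewrite !mxE; ring.
  by have [//|_] := ger0P ((y + z - x) 0 i); rewrite mulrN cosN.
by apply: mono; [exact: ltW|exact: tle].
Qed.

End kernel.

(** * Uniform approximation by free waves *)

Definition free_wave (R : realType) (N d l k : nat) (A : hdiffop R N d l k) (q : wave R N d) :=
  [/\ int_row q.2.2, q.2.2 != 0 & q.1 *m symbol A q.2.2 = 0].

(** The error is the mean of [f y - f x] against the nonnegative normalized kernel centred at [x].
    Averaging the assumed bound leaves [e] and [N] moments, each equal to [1 / M.+1%:R]. *)
Lemma trig_kernel_approx (R : realType) (N : nat) (f : 'rV[R]_N -> R) C e M (s : seq 'I_N) :
  cper f -> 0 <= C ->
  (forall x y, `|f y - f x| <= e + C * \sum_i (1 - pcos 0 (delta_mx 0 i) (y - x))) ->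
  (forall i, count_mem i s = M) -> forall x,
  `|torus_integral (fun y => trig_kernel s (y - x) * f y) / torus_integral (trig_kernel s) - f x| <=
  e + C * N%:R / M.+1%:R.
Proof.
move=> cf C0 H sM x.
have cKx : cper (fun y => trig_kernel s (y - x)) by apply: cper_shift; exact: cper_trig_kernel.
have K0 := @torus_integral_trig_kernel_gt0 R N s.
have cI i : cper (fun y : 'rV[R]_N => 1 - pcos 0 (delta_mx 0 i) y).
  by apply: cperB; [exact: cper_cst|exact/cper_pcos/int_row_delta].
have cG : cper (fun y => e + C * \sum_i (1 - pcos 0 (delta_mx 0 i) (y - x))).
  apply: cperD; first exact: cper_cst.
  by apply/cperZ/cper_sum => i; exact: (cper_shift (- x) (cI i)).
have cD : cper (fun y => f y - f x) by apply: cperB => //; exact: cper_cst.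
have E : torus_integral (fun y => trig_kernel s (y - x) * f y) - f x * torus_integral
  (trig_kernel s) =
    torus_integral (fun y => trig_kernel s (y - x) * (f y - f x)).
  rewrite -(torus_integral_shift (- x) (cper_trig_kernel s)) -torus_integralZ//.
  rewrite -torus_integralB; [|exact: cperM|exact: cperZ].
  by congr torus_integral; apply/funext => y; ring.
have B : torus_integral (fun y => trig_kernel s (y - x) * (e +
  C * \sum_i (1 - pcos 0 (delta_mx 0 i) (y - x)))) =
    torus_integral (trig_kernel s) * (e + C * N%:R / M.+1%:R).
  rewrite (_ : (fun y => _) = (fun y =>
     e * trig_kernel s (y - x) + C * \sum_i trig_kernel s (y - x) * (1 - pcos 0 (delta_mx 0 i) (y
       - x)))); last first.
    by apply/funext => y; rewrite -mulr_sumr; ring.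
  have cKi i : cper (fun y => trig_kernel s (y - x) * (1 - pcos 0 (delta_mx 0 i) (y - x))).
    by apply: cperM => //; exact: (cper_shift (- x) (cI i)).
  rewrite torus_integralD; [|exact: cperZ|by apply/cperZ/cper_sum].
  rewrite !torus_integralZ//; last exact: cper_sum.
  rewrite torus_integral_sum// (torus_integral_shift (- x) (cper_trig_kernel s)).
  under eq_bigr => i _.
    rewrite (torus_integral_shift (- x) (cperM (cper_trig_kernel s) (cI i))).
    rewrite torus_integral_trig_kernel_moment sM; over.
  by rewrite sumr_const card_ord -mulr_natr; ring.
rewrite -[f x](mulfK (lt0r_neq0 K0)) -mulrBl normrM normfV (gtr0_norm K0) ler_pdivrMr//.
rewrite E [leRHS]mulrC -B ler_norml -mulN1r -torus_integralZ; last exact: cperM.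
have bnd y := H x y.
apply/andP; split; apply: le_torus_integral; try by [apply: cperM|apply/cperZ/cperM].
  move=> y; rewrite mulN1r -mulrN ler_wpM2l ?trig_kernel_ge0//.
  by have := bnd y; rewrite ler_norml => /andP[].
by move=> y; rewrite ler_wpM2l ?trig_kernel_ge0// (le_trans (ler_norm _)).
Qed.

Lemma pcosB0 (R : realType) (N : nat) (n x y : 'rV[R]_N) :
  pcos 0 n (y - x) = pcos 0 n y * pcos 0 n x + pcos (- (pi / 2)) n y * pcos (- (pi / 2)) n x.
Proof.
by rewrite /pcos dotvBr !add0r ![- (pi / 2) + _]addrC !cosBpihalf -cosB mulrBr.
Qed.

Lemma wave_approx (R : realType) (N d l k : nat) (A : hdiffop R N d l k)
    (u : 'rV[R]_N -> 'rV[R]_d) (e : R) :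
  smooth u -> unit_periodic u -> (forall x, apply_op A u x = 0) ->
  (forall j, torus_integral (fun y => u y 0 j) = 0) -> 0 < e ->
  exists L : seq (wave R N d), (forall q, q \in L -> free_wave A q) /\
    forall x, `|waves L x - u x| <= e.
Proof.
move=> su pu Au u0 e0.
have cu j : cper (fun x => u x 0 j) by apply: cper_coord => //; exact: smooth_continuous.
have e20 : 0 < e / 2 by rewrite divr_gt0.
have /choice[C HC] : forall j, exists C, 0 <= C /\ forall x y,
    `|u y 0 j - u x 0 j| <= e / 2 + C * \sum_i (1 - pcos 0 (delta_mx 0 i) (y - x)).
  by move=> j; have [C C0 H] := cper_cos_modulus (cu j) e20; exists C.
(* Once [M] exceeds [D], the error [C j * N%:R / M.+1%:R] is at most [e / 2]; the sum of the [C j]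
   serves all coordinates at once. *)
pose D := (\sum_j C j) * N%:R / (e / 2).
have D0 : 0 <= D by rewrite !mulr_ge0 ?invr_ge0 ?(ltW e20)// sumr_ge0// => j _; case: (HC j).
pose M := Num.bound D.
pose s := flatten (nseq M (enum 'I_N)).
have sM i : count_mem i s = M.
  rewrite /s; elim: (M) => [//|m IH] /=; rewrite count_cat IH.
  by rewrite count_uniq_mem ?enum_uniq// mem_enum.
have [T [Ti TE]] := @trig_kernel_cos_sum R N s.
have K0 := @torus_integral_trig_kernel_gt0 R N s; set K := torus_integral (trig_kernel s) in K0.
pose coef th (n : 'rV[R]_N) : 'rV[R]_d := \row_j torus_integral (fun x => u x 0 j * pcos th n x).
(* By [pcosB0] each term of the kernel yields a cosine and a sine wave, whose amplitudes are the
   cosine and sine coefficients of [u]. *)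
pose wv th (t : R * 'rV[R]_N) : wave R N d := ((t.1 / K) *: coef th t.2, (th, t.2)).
(* Free waves have nonzero frequency; the discarded terms are multiples of the mean of [u], which is
   zero. *)
pose T' := [seq t <- T | t.2 != 0].
exists ([seq wv 0 t | t <- T'] ++ [seq wv (- (pi / 2)) t | t <- T']); split.
  have fw th t : t \in T' -> free_wave A (wv th t).
    rewrite mem_filter => /andP[t0 /Ti ti]; split => //=.
    by rewrite -scalemxAl fourier_coef_ker// scaler0.
  by move=> q; rewrite mem_cat => /orP[]/mapP[t tT ->]; exact: fw.
move=> x; apply/norm_rV_le => [|j]; first exact: ltW.
have E : waves ([seq wv 0 t | t <- T'] ++ [seq wv (- (pi / 2)) t | t <- T']) x 0 j =
  torus_integral (fun y => trig_kernel s (y - x) * u y 0 j) / K.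
  have -> : (fun y => trig_kernel s (y - x) * u y 0 j) = (fun y => \sum_(t <- T)
      (t.1 * pcos 0 t.2 x * (u y 0 j * pcos 0 t.2 y) +
       t.1 * pcos (- (pi / 2)) t.2 x * (u y 0 j * pcos (- (pi / 2)) t.2 y))).
    apply/funext => y; rewrite TE mulr_suml; apply: eq_bigr => t _.
    by rewrite pcosB0; ring.
  rewrite wavesE big_cat /= !big_map /T' !big_filter -big_split /=.
  have -> : torus_integral (fun y => \sum_(t <- T)
      (t.1 * pcos 0 t.2 x * (u y 0 j * pcos 0 t.2 y) +
       t.1 * pcos (- (pi / 2)) t.2 x * (u y 0 j * pcos (- (pi / 2)) t.2 y))) =
     \sum_(t <- T) (t.1 * pcos 0 t.2 x * coef 0 t.2 0 j +
       t.1 * pcos (- (pi / 2)) t.2 x * coef (- (pi / 2)) t.2 0 j).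
    have cp th (n : 'rV[R]_N) : int_row n -> cper (fun y => u y 0 j * pcos th n y).
      by move=> ni; apply: cperM => //; exact: cper_pcos.
    elim: T Ti {TE T'} => [|t T IH] Ti.
      by under [X in torus_integral X]funext do rewrite big_nil; rewrite torus_integral_cst big_nil.
    under [X in torus_integral X]funext do rewrite big_cons.
    have ti : int_row t.2 by apply: Ti; rewrite mem_head.
    have Ti' t' : t' \in T -> int_row t'.2 by move=> h; apply: Ti; rewrite inE h orbT.
    rewrite torus_integralD ?IH// ?big_cons.
    - rewrite torus_integralD; [|exact/cperZ/cp|exact/cperZ/cp].
      by rewrite !torus_integralZ; [|exact: cp|exact: cp]; rewrite !mxE.
    - by apply: cperD; exact/cperZ/cp.
    - elim: T Ti' {IH Ti} => [|t' T IH] Ti.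
        by under [X in cper X]funext do rewrite big_nil; exact: cper_cst.
      under [X in cper X]funext do rewrite big_cons.
      have ti' : int_row t'.2 by apply: Ti; rewrite mem_head.
      apply: cperD; first by apply: cperD; exact/cperZ/cp.
      by apply: IH => t'' h; apply: Ti; rewrite inE h orbT.
  rewrite mulr_suml [in RHS](bigID (fun t => t.2 != 0)) /=.
  rewrite [X in _ = _ + X]big1 ?addr0.
    by apply: eq_bigr => t _; rewrite !mxE; ring.
  move=> t /negPn/eqP ->.
  have z th : torus_integral (fun y => u y 0 j * pcos th 0 y) = 0.
    under [X in torus_integral X]funext do rewrite /pcos dotv0l mulr0 addr0 mulrC.
    by rewrite torus_integralZ// u0 mulr0.
  by rewrite !mxE !z !mulr0 addr0 mul0r.
rewrite !mxE E.
have [C0 HCj] := HC j.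
apply: (le_trans (trig_kernel_approx (cu j) C0 HCj sM x)).
rewrite [leRHS]splitr lerD2l ler_pdivrMr ?ltr0n//.
have CjC : C j <= \sum_j C j.
  by rewrite (bigD1 j)//= lerDl sumr_ge0// => i _; case: (HC i).
apply: (@le_trans _ _ ((\sum_j C j) * N%:R)); first by rewrite ler_wpM2r.
have /ltW := archi_boundP D0; rewrite -/M {1}/D ler_pdivrMr// => /le_trans; apply.
by rewrite mulrC ler_wpM2l ?(ltW e20)// ler_nat.
Qed.

(** * Polynomial functions and directional derivatives *)

(** Polynomial functions as a closure, so that differentiability and the symmetry of second
    derivatives follow by induction on the construction. *)
Inductive polyf (R : realType) (d : nat) : ('rV[R]_d -> R) -> Prop :=
| polyf_cst c : polyf (fun=> c)
| polyf_coord i : polyf (fun x => x 0 i)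
| polyfD f g : polyf f -> polyf g -> polyf (fun x => f x + g x)
| polyfM f g : polyf f -> polyf g -> polyf (fun x => f x * g x).

Section polyf.
Context {R : realType} {d : nat}.
Implicit Types (f g F : 'rV[R]_d -> R) (u v x : 'rV[R]_d).

Lemma polyf_sum (I : Type) (s : seq I) (f : I -> 'rV[R]_d -> R) :
  (forall i, polyf (f i)) -> polyf (fun x => \sum_(i <- s) f i x).
Proof.
move=> cf; elim: s => [|i s IH].
  by under [X in polyf X]funext do rewrite big_nil; exact: polyf_cst.
by under [X in polyf X]funext do rewrite big_cons; exact: polyfD.
Qed.

Lemma polyf_prod (I : Type) (s : seq I) (f : I -> 'rV[R]_d -> R) :
  (forall i, polyf (f i)) -> polyf (fun x => \prod_(i <- s) f i x).
Proof.
move=> cf; elim: s => [|i s IH].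
  by under [X in polyf X]funext do rewrite big_nil; exact: polyf_cst.
by under [X in polyf X]funext do rewrite big_cons; exact: polyfM.
Qed.

Lemma polyf_exp f n : polyf f -> polyf (fun x => f x ^+ n).
Proof.
move=> pf; elim: n => [|n IH].
  by under [X in polyf X]funext do rewrite expr0; exact: polyf_cst.
by under [X in polyf X]funext do rewrite exprS; exact: polyfM.
Qed.

Lemma polynomial_funP F : polynomial_fun F <-> polyf F.
Proof.
split=> [[p pE]|].
  have -> : F = (fun x => meval (fun j => x 0 j) p) by apply/funext.
  under [X in polyf X]funext do rewrite mevalE.
  apply: polyf_sum => m; apply: polyfM; first exact: polyf_cst.
  by apply: polyf_prod => i; apply: polyf_exp; exact: polyf_coord.
elim=> [c|i|f g _ [p pE] _ [q qE]|f g _ [p pE] _ [q qE]].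
- by exists (mpolyC d c) => x; rewrite mevalC.
- by exists (mpolyX R (mnm1 i)) => x; rewrite mevalXU.
- by exists (p + q) => x; rewrite mevalD pE qE.
- by exists (p * q) => x; rewrite mevalM pE qE.
Qed.

Lemma polyf_differentiable F x : polyf F -> differentiable F x.
Proof.
elim=> [c|i|f g _ df _ dg|f g _ df _ dg].
- exact: differentiable_cst.
- exact: differentiable_coord.
- exact: differentiableD.
- exact: differentiableM.
Qed.

Lemma polyf_continuous F : polyf F -> continuous F.
Proof. by move=> pF x; exact/differentiable_continuous/polyf_differentiable. Qed.

Lemma polyf_derivable F x v : polyf F -> derivable F x v.
Proof. by move=> pF; exact/diff_derivable/polyf_differentiable. Qed.

(* Locked, because unification diverges when it unfolds ['d]. *)
Definition dird : 'rV[R]_d -> ('rV[R]_d -> R) -> 'rV[R]_d -> R :=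
  locked (fun u F x => 'd F x u).

Lemma dird_diff u F x : dird u F x = 'd F x u.
Proof. by rewrite /dird -lock. Qed.

Lemma dirdE F u x : polyf F -> dird u F x = 'D_u F x.
Proof. by move=> pF; rewrite dird_diff deriveE//; exact: polyf_differentiable. Qed.

Lemma dird_cst u c : dird u (fun=> c) = fun=> 0.
Proof.
by apply/funext => x; rewrite dirdE; [exact: derive_cst|exact: polyf_cst].
Qed.

Lemma dird_coord u i : dird u (fun x => x 0 i) = fun=> u 0 i.
Proof.
apply/funext => x; rewrite dirdE; last exact: polyf_coord.
by have [_] := is_derive_coord i (is_derive_id x u).
Qed.

Lemma dirdD u f g : polyf f -> polyf g ->
  dird u (fun x => f x + g x) = (fun x => dird u f x + dird u g x).
Proof.
move=> pf pg; apply/funext => x; rewrite !dirdE//; last exact: polyfD.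
by rewrite -deriveD//; exact: polyf_derivable.
Qed.

Lemma dirdM u f g : polyf f -> polyf g ->
  dird u (fun x => f x * g x) = (fun x => f x * dird u g x + g x * dird u f x).
Proof.
move=> pf pg; apply/funext => x; rewrite !dirdE//; last exact: polyfM.
exact: (deriveM (polyf_derivable pf) (polyf_derivable pg)).
Qed.

Lemma polyf_dird u F : polyf F -> polyf (dird u F).
Proof.
elim=> [c|i|f g pf df pg dg|f g pf df pg dg].
- by rewrite dird_cst; exact: polyf_cst.
- by rewrite dird_coord; exact: polyf_cst.
- by rewrite dirdD//; exact: polyfD.
- by rewrite dirdM//; apply: polyfD; exact: polyfM.
Qed.

Lemma dirdC u v F : polyf F -> dird u (dird v F) = dird v (dird u F).
Proof.
have pD h w (ph : polyf h) := @polyf_dird w _ ph.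
elim=> [c|i|f g pf df pg dg|f g pf df pg dg].
- by rewrite !dird_cst.
- by rewrite !dird_coord !dird_cst.
- by rewrite (dirdD v pf pg) (dirdD u pf pg) (dirdD u (pD f v pf) (pD g v pg))
    (dirdD v (pD f u pf) (pD g u pg)) df dg.
- rewrite (dirdM v pf pg) (dirdM u pf pg).
  rewrite (dirdD u (polyfM pf (pD g v pg)) (polyfM pg (pD f v pf))).
  rewrite (dirdD v (polyfM pf (pD g u pg)) (polyfM pg (pD f u pf))).
  rewrite (dirdM u pf (pD g v pg)) (dirdM u pg (pD f v pf)).
  rewrite (dirdM v pf (pD g u pg)) (dirdM v pg (pD f u pf)).
  apply/funext => x; rewrite df dg.
  move: (dird v (dird u f) x) (dird v (dird u g) x) (dird u f x) (dird u g x) => a b c e.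
  move: (dird v f x) (dird v g x) (f x) (g x) => a' b' c' e'.
  by ring.
Qed.

Lemma dird0 F : dird 0 F = fun=> 0.
Proof. by apply/funext => x; rewrite dird_diff linear0. Qed.

Lemma dird_sum F v x : dird v F x = \sum_j v 0 j * dird (delta_mx 0 j) F x.
Proof.
rewrite dird_diff [v in LHS]row_sum_delta linear_sum; apply: eq_bigr => j _.
by rewrite linearZ dird_diff.
Qed.

Lemma iter_diff_cons F v vs : iter_diff F (v :: vs) = dird v (iter_diff F vs).
Proof. by apply/funext => x; rewrite dird_diff. Qed.

Lemma iter_diff_cat F us vs : iter_diff F (us ++ vs) = iter_diff (iter_diff F vs) us.
Proof. by elim: us => [//|u us IH]; rewrite cat_cons !iter_diff_cons IH. Qed.

Lemma polyf_iter_diff F vs : polyf F -> polyf (iter_diff F vs).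
Proof. by move=> pF; elim: vs => [//|v vs IH]; rewrite iter_diff_cons; exact: polyf_dird. Qed.

Lemma iter_diff_zero vs : iter_diff (fun _ : 'rV[R]_d => 0) vs = fun=> 0.
Proof. by elim: vs => [//|v vs IH]; rewrite iter_diff_cons IH dird_cst. Qed.

Lemma iter_diff_swap F u vs : polyf F -> iter_diff F (u :: vs) = iter_diff (dird u F) vs.
Proof.
move=> pF; elim: vs => [|v vs IH]; first exact: iter_diff_cons.
rewrite !iter_diff_cons dirdC; last exact: polyf_iter_diff.
by rewrite -IH iter_diff_cons.
Qed.

Lemma iter_diff_mid F us v vs : polyf F ->
  iter_diff F (us ++ v :: vs) = iter_diff F (v :: us ++ vs).
Proof.
move=> pF; rewrite iter_diff_cat !iter_diff_cons iter_diff_cat -[RHS]iter_diff_cons.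
by rewrite iter_diff_swap//; exact: polyf_iter_diff.
Qed.

Lemma polyf_affine F u z c : polyf F -> dird u (dird u F) = (fun=> 0) ->
  F (z + c *: u) = F z + c * dird u F z.
Proof.
move=> pF F2.
have der G (t : R) : polyf G -> is_derive t (1 : R) (fun s => G (z + s *: u)) (dird u G (z + t *:
  u)).
  by move=> pG; rewrite dirdE//; apply: is_derive_line; exact: polyf_derivable.
have dF t : dird u F (z + t *: u) = dird u F z.
  rewrite -[in RHS](addr0 z) -(scale0r u).
  apply: (@is_derive_0_is_cst R (fun t => dird u F (z + t *: u))) => s.
  by have := der _ s (@polyf_dird u _ pF); rewrite F2.
pose G (t : R) := F (z + t *: u) - t * dird u F z.
have dG (s : R) : is_derive s (1 : R) G 0.
  apply: is_derive_eq.
    exact: (is_deriveB (der _ s pF) (is_deriveM (is_derive_id s (1 :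
      R)) (is_derive_cst (dird u F z) s (1 : R)))).
  by rewrite dF scaler0 add0r [_ *: 1]mulr1 subrr.
have := is_derive_0_is_cst c 0 dG.
by rewrite /G mul0r subr0 scale0r addr0 => /eqP; rewrite subr_eq => /eqP.
Qed.

End polyf.

(** Removing one term [c i x *: u i] replaces [M] by its values at the base points [z] and
    [z + u i], combined with the polynomial coefficient [c i x]. After all removals only values of
    [M] at fixed points remain. *)
Lemma polyf_multiaffine (R : realType) (d : nat) (M : 'rV[R]_d -> R) (I : Type) (r : seq I)
    (u : I -> 'rV[R]_d) (c : I -> 'rV[R]_d -> R) :
  (forall i, polyf (c i)) ->
  (forall i v t, M (v + t *: u i) = M v + t * (M (v + u i) - M v)) ->
  (forall x, x = \sum_(i <- r) c i x *: u i) -> polyf M.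
Proof.
move=> pc aff xE.
suff H s z : polyf (fun x => M (z + \sum_(i <- s) c i x *: u i)).
  have := H r 0; congr polyf; apply/funext => x; by rewrite add0r -xE.
elim: s z => [|i s IH] z.
  by under [X in polyf X]funext do rewrite big_nil; exact: polyf_cst.
have -> : (fun x => M (z + \sum_(j <- i :: s) c j x *: u j)) =
  (fun x => M (z + \sum_(j <- s) c j x *: u j) + c i x *
    (M (z + u i + \sum_(j <- s) c j x *: u j) + -1 * M (z + \sum_(j <- s) c j x *: u j))).
  apply/funext => x; rewrite big_cons addrCA addrC aff mulN1r.
  by congr (_ + _ * (M _ - _)); rewrite addrAC.
apply: polyfD => //; apply: polyfM => //; apply: polyfD => //; apply: polyfM => //.
exact: polyf_cst.
Qed.

(** * Vanishing along dependent frequencies *)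

(** Polynomial along every line: enough for the identity principle [linepoly_eq0], and stable under
    composition with linear maps between arbitrary spaces. *)
Variant linepoly (R : realType) (V : lmodType R) (g : V -> R) : Prop :=
  Linepoly of forall x v, exists q : {poly R}, forall t, g (x + t *: v) = q.[t].

Section linepoly.
Context {R : realType} {V : lmodType R}.
Implicit Types f g : V -> R.

Lemma linepoly_cst c : linepoly (fun _ : V => c).
Proof. by split=> x v; exists c%:P => t; rewrite hornerC. Qed.

Lemma linepolyD f g : linepoly f -> linepoly g -> linepoly (fun x => f x + g x).
Proof.
move=> [pf] [pg]; split=> x v; have [p pE] := pf x v; have [q qE] := pg x v.
by exists (p + q) => t; rewrite hornerD pE qE.
Qed.

Lemma linepolyM f g : linepoly f -> linepoly g -> linepoly (fun x => f x * g x).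
Proof.
move=> [pf] [pg]; split=> x v; have [p pE] := pf x v; have [q qE] := pg x v.
by exists (p * q) => t; rewrite hornerM pE qE.
Qed.

Lemma linepoly_sum (I : Type) (s : seq I) (P : pred I) (f : I -> V -> R) :
  (forall i, linepoly (f i)) -> linepoly (fun x => \sum_(i <- s | P i) f i x).
Proof.
move=> cf; elim: s => [|i s IH].
  by under [X in linepoly X]funext do rewrite big_nil; exact: linepoly_cst.
under [X in linepoly X]funext do rewrite big_cons.
by case: (P i); [exact: (linepolyD (cf i) IH)|exact: IH].
Qed.

Lemma linepoly_prod (I : Type) (s : seq I) (f : I -> V -> R) :
  (forall i, linepoly (f i)) -> linepoly (fun x => \prod_(i <- s) f i x).
Proof.
move=> cf; elim: s => [|i s IH].
  by under [X in linepoly X]funext do rewrite big_nil; exact: linepoly_cst.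
by under [X in linepoly X]funext do rewrite big_cons; exact: (linepolyM (cf i) IH).
Qed.

Lemma linepoly_exp f n : linepoly f -> linepoly (fun x => f x ^+ n).
Proof.
move=> pf; elim: n => [|n IH].
  by under [X in linepoly X]funext do rewrite expr0; exact: linepoly_cst.
by under [X in linepoly X]funext do rewrite exprS; exact: (linepolyM pf IH).
Qed.

End linepoly.

Lemma linepoly_comp (R : realType) (V W : lmodType R) (h : {linear V -> W}) (g : W -> R) :
  linepoly g -> linepoly (fun x => g (h x)).
Proof.
by move=> [pg]; split=> x v; have [q qE] := pg (h x) (h v); exists q => t;
  rewrite linearD linearZ -qE.
Qed.

Lemma linepoly_entry (R : realType) m n (i : 'I_m) (j : 'I_n) :
  linepoly (fun X : 'M[R]_(m, n) => X i j).
Proof.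
split=> x v; exists ((x i j)%:P + (v i j)%:P * 'X) => t.
by rewrite !mxE hornerD hornerMX !hornerC mulrC.
Qed.

Lemma poly_eq0_infinite (R : realType) (q : {poly R}) (a : R) :
  (forall k : nat, q.[k.+1%:R - a] = 0) -> q = 0.
Proof.
move=> q0; apply: (@roots_geq_poly_eq0 _ _ [seq k.+1%:R - a | k <- iota 0 (size q)]).
- by apply/allP => _ /mapP[k _ ->]; rewrite rootE q0.
- rewrite map_inj_uniq ?iota_uniq// => i j /addIr/eqP; rewrite eqr_nat => /eqP.
  by case.
- by rewrite size_map size_iota.
Qed.

(** The entries are released one by one: [s] lists those already arbitrary. Along [delta_mx i j] the
    function is a polynomial in one variable that vanishes whenever the entry is a positive integer,
    that is, infinitely often. *)
Lemma linepoly_eq0 (R : realType) m n (g : 'M[R]_(m, n) -> R) : linepoly g ->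
  (forall X : 'M[R]_(m, n), (forall i j, exists k : nat, X i j = k.+1%:R) -> g X = 0) ->
  forall X, g X = 0.
Proof.
move=> [pg] g0.
suff H (s : seq ('I_m * 'I_n)) (X : 'M[R]_(m, n)) :
    (forall i j, (i, j) \notin s -> exists k : nat, X i j = k.+1%:R) -> g X = 0.
  by move=> X; apply: (H (enum {: 'I_m * 'I_n})) => i j; rewrite mem_enum.
elim: s X => [|[i j] s IH] X Xs; first by apply: g0 => i j; exact: Xs.
have [q qE] := pg X (delta_mx i j).
have q0 : q = 0.
  apply: (@poly_eq0_infinite _ _ (X i j)) => k; rewrite -qE; apply: IH => i' j' ij'.
  rewrite !mxE; have [[-> ->]|/eqP neq] := (i', j') =P (i, j).
    by exists k; rewrite !eqxx mulr1 addrC subrK.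
  have -> : (i' == i) && (j' == j) = false.
    by apply/negbTE; move: neq; apply: contra => /andP[/eqP -> /eqP ->].
  by rewrite mulr0 addr0; apply: Xs; rewrite inE negb_or neq.
by rewrite -[X]addr0 -(scale0r (delta_mx i j)) qE q0 horner0.
Qed.

Lemma linepoly_symbol (R : realType) (N m d k : nat) (B : hdiffop R N m d k) i j :
  linepoly (fun xi => symbol B xi i j).
Proof.
under [X in linepoly X]funext do rewrite summxE.
apply: linepoly_sum => al; under [X in linepoly X]funext do rewrite mxE.
apply: linepolyM; last exact: linepoly_cst.
by apply: linepoly_prod => a; apply: linepoly_exp; exact: linepoly_entry.
Qed.

Lemma linepoly_mul_symbol (R : realType) (N m d k : nat) (B : hdiffop R N m d k)
    (w : 'rV[R]_m) j : linepoly (fun xi => (w *m symbol B xi) 0 j).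
Proof.
under [X in linepoly X]funext do rewrite mxE.
apply: linepoly_sum => a; apply: linepolyM; first exact: linepoly_cst.
exact: linepoly_symbol.
Qed.

Lemma linepoly_iter_diff (R : realType) (d : nat) (V : lmodType R) (M : 'rV[R]_d -> R)
    (I : eqType) (fs : seq I) (f : I -> V -> 'rV[R]_d) x : polyf M ->
  (forall i, i \in fs -> forall j, linepoly (fun X => f i X 0 j)) ->
  linepoly (fun X => iter_diff M [seq f i X | i <- fs] x).
Proof.
elim: fs M => [|i fs IH] M pM pf; first exact: linepoly_cst.
have -> : (fun X => iter_diff M [seq f i X | i <- i :: fs] x) =
  (fun X => \sum_j f i X 0 j * iter_diff (dird (delta_mx 0 j) M) [seq f i X | i <- fs] x).
  apply/funext => X; rewrite map_cons iter_diff_cons dird_sum; apply: eq_bigr => j _.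
  (* The first direction becomes the innermost one, so that the induction hypothesis applies to the
     polynomial [dird (delta_mx 0 j) M]. *)
  by rewrite -iter_diff_cons iter_diff_swap.
apply: linepoly_sum => j; apply: linepolyM; first by apply: pf; rewrite mem_head.
by apply: IH => [|i' i'fs]; [exact: polyf_dird|apply: pf; rewrite inE i'fs orbT].
Qed.

(* [g] is a polynomial of degree less than [k], in terms of iterated differences. *)
Fixpoint deg_lt (R : realType) (V : lmodType R) (k : nat) (g : V -> R) : Prop :=
  match k with
  | 0 => forall x, g x = 0
  | k'.+1 => forall v, deg_lt k' (fun x => g (x + v) - g x)
  end.

Section deg_lt.
Context {R : realType} {V : lmodType R}.
Implicit Types f g : V -> R.

Lemma deg_lt_ext k f g : f =1 g -> deg_lt k f -> deg_lt k g.
Proof. by move=> /funext ->. Qed.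

Lemma deg_ltS k g : deg_lt k g -> deg_lt k.+1 g.
Proof.
elim: k g => [|k IH] g /= H v; first by move=> x; rewrite !H subrr.
exact: IH.
Qed.

Lemma deg_ltW k k' g : (k <= k')%N -> deg_lt k g -> deg_lt k' g.
Proof. by move=> /subnK <-; elim: (_ - _)%N => [//|n IH] /IH; exact: deg_ltS. Qed.

Lemma deg_lt_add k f g : deg_lt k f -> deg_lt k g -> deg_lt k (fun x => f x + g x).
Proof.
elim: k f g => [|k IH] f g /= Hf Hg; first by move=> x; rewrite Hf Hg addr0.
move=> v; apply: deg_lt_ext (IH _ _ (Hf v) (Hg v)) => x /=; ring.
Qed.

Lemma deg_lt_scale k c g : deg_lt k g -> deg_lt k (fun x => c * g x).
Proof.
elim: k g => [|k IH] g /= Hg; first by move=> x; rewrite Hg mulr0.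
move=> v; apply: deg_lt_ext (IH _ (Hg v)) => x /=; ring.
Qed.

Lemma deg_lt_shift k g v : deg_lt k g -> deg_lt k (fun x => g (x + v)).
Proof.
elim: k g => [|k IH] g /= Hg; first by move=> x; rewrite Hg.
move=> w; apply: deg_lt_ext (IH _ (Hg w)) => x /=.
by rewrite addrAC.
Qed.

Lemma deg_lt_zero k : deg_lt k (fun _ : V => 0).
Proof. by elim: k => [//|k IH] v /=; apply: deg_lt_ext IH => x; rewrite subrr. Qed.

Lemma deg_lt_sum k (I : Type) (s : seq I) (f : I -> V -> R) :
  (forall i, deg_lt k (f i)) -> deg_lt k (fun x => \sum_(i <- s) f i x).
Proof.
move=> Hf; elim: s => [|i s IH].
  by under [X in deg_lt _ X]funext do rewrite big_nil; exact: deg_lt_zero.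
by under [X in deg_lt _ X]funext do rewrite big_cons; exact: deg_lt_add.
Qed.

(** Discrete Leibniz rule: the difference of [l * g] with step [v] is [l x * (g (x + v) - g x) + l v
    * g (x + v)]. *)
Lemma deg_lt_mul_linear k (l : V -> R) g : (forall x y, l (x + y) = l x + l y) ->
  deg_lt k g -> deg_lt k.+1 (fun x => l x * g x).
Proof.
move=> lD; elim: k g => [|k IH] g Hg v; first by move=> x; rewrite !Hg !mulr0 subrr.
have H1 := IH _ (Hg v); have H2 := deg_lt_scale (l v) (deg_lt_shift v Hg).
by apply: deg_lt_ext (deg_lt_add H1 H2) => x /=; rewrite lD; ring.
Qed.

(** The iterated difference at the origin with steps [e i] is an alternating sum of [g] over all
    subsums. The degree bound makes it zero, so the value at the full sum vanishes with those at the
    proper subsums. The induction takes one difference at a time. *)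
Lemma deg_lt_subsums (I : Type) (s : seq I) (e : I -> V) g : deg_lt (size s) g ->
  (forall b, size b = size s -> ~~ all id b -> g (\sum_(i <- mask b s) e i) = 0) ->
  g (\sum_(i <- s) e i) = 0.
Proof.
elim: s g => [|i s IH] g Hg H; first by rewrite Hg.
have H0 b : size b = size s -> g (\sum_(j <- mask b s) e j) = 0.
  by move=> bs; apply: (H (false :: b)) => //=; rewrite bs.
have Hs : g (\sum_(j <- s) e j) = 0.
  by rewrite -(H0 (nseq (size s) true)) ?size_nseq// mask_true.
have : g (\sum_(j <- s) e j + e i) - g (\sum_(j <- s) e j) = 0.
  apply: (IH _ (Hg (e i))) => b bs nb; rewrite H0// subr0.
  by have := H (true :: b); rewrite /= big_cons addrC; apply => //=; rewrite bs.
by rewrite Hs subr0 big_cons addrC.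
Qed.

End deg_lt.

Lemma deg_lt_monomial (R : realType) (N : nat) (e : 'I_N -> nat) :
  deg_lt (\sum_(a < N) e a).+1 (fun xi : 'rV[R]_N => \prod_(a < N) xi 0 a ^+ e a).
Proof.
elim: (index_enum _) => [|a s IH].
  rewrite big_nil (_ : (fun _ => _) = (fun=> 1)); first by move=> v x; rewrite subrr.
  by apply/funext => xi; rewrite big_nil.
rewrite big_cons.
have -> : (fun xi : 'rV[R]_N => \prod_(b <- a :: s) xi 0 b ^+ e b) =
  (fun xi => xi 0 a ^+ e a * \prod_(b <- s) xi 0 b ^+ e b).
  by apply/funext => xi; rewrite big_cons.
elim: (e a) => [|n IHn].
  by apply: deg_lt_ext IH => xi; rewrite expr0 mul1r.
have := @deg_lt_mul_linear R 'rV[R]_N _ (fun xi => xi 0 a) _ _ IHn.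
rewrite addSn => H; apply: deg_lt_ext (H _) => [xi|x y]; last by rewrite mxE.
by rewrite exprS mulrA.
Qed.

Lemma deg_lt_symbol (R : realType) (N m d k : nat) (B : hdiffop R N m d k) i j :
  deg_lt k.+1 (fun xi => symbol B xi i j).
Proof.
have -> : (fun xi => symbol B xi i j) = (fun xi : 'rV[R]_N => \sum_(al : multi_index N k)
  B al i j * \prod_(a < N) xi 0 a ^+ val al a).
  by apply/funext => xi; rewrite /symbol summxE; apply: eq_bigr => al _; rewrite mxE mulrC.
apply: deg_lt_sum => al; apply: deg_lt_scale.
have sk : (\sum_(a < N) val al a)%N = k by apply/eqP; exact: (valP al).
have := @deg_lt_monomial R N (fun a => nat_of_ord (val al a)); rewrite sk.
by apply: deg_lt_ext => xi; apply: eq_bigr.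
Qed.

Lemma symbolZ (R : realType) (N m d k : nat) (B : hdiffop R N m d k) c xi :
  symbol B (c *: xi) = c ^+ k *: symbol B xi.
Proof.
rewrite /symbol scaler_sumr; apply: eq_bigr => al _; rewrite scalerA; congr (_ *: _).
rewrite -[X in _ ^+ X](eqP (valP al)) -prodrXr -big_split /=.
by apply: eq_bigr => i _; rewrite mxE exprMn.
Qed.

Lemma symbol0 (R : realType) (N m d k : nat) (B : hdiffop R N m d k) :
  (0 < k)%N -> symbol B 0 = 0.
Proof.
move=> k0; have := symbolZ B 0 0; rewrite scale0r expr0n.
by rewrite gtn_eqF// scale0r.
Qed.

Lemma span_zip (R : realType) (N : nat) (T : Type) (f : T -> 'rV[R]_N) (s : seq T) v :
  v \in <<[seq f t | t <- s]>>%VS ->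
  exists Z : seq (R * T), [seq z.2 | z <- Z] = s /\ v = \sum_(z <- Z) z.1 *: f z.2.
Proof.
elim: s v => [|t s IH] v.
  by rewrite span_nil memv0 => /eqP ->; exists [::]; rewrite big_nil.
rewrite map_cons span_cons => /memv_addP[u /vlineP[c ->] [v' /IH[Z [<- ->]] ->]].
by exists ((c, t) :: Z); rewrite big_cons.
Qed.

Lemma nfree_split (R : realType) (N : nat) (T : Type) (f : T -> 'rV[R]_N) (s : seq T) :
  ~~ free [seq f t | t <- s] ->
  exists s1 t s2, s = s1 ++ t :: s2 /\ f t \in <<[seq f t | t <- s2]>>%VS.
Proof.
elim: s => [|t s IH]; first by rewrite nil_free.
rewrite map_cons free_cons negb_and negbK => /orP[ts|/IH[s1 [t' [s2 [-> ts]]]]].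
  by exists [::], t, s.
by exists (t :: s1), t', s2.
Qed.

(** Exhibits a position skipped by the mask; the derivative at that position can then be taken
    last. *)
Lemma mask_remove (T : eqType) (b : bitseq) (s : seq T) : size b = size s -> ~~ all id b ->
  exists s1 t s2, s = s1 ++ t :: s2 /\ {subset mask b s <= s1 ++ s2}.
Proof.
elim: s b => [|t s IH] [|[] b]//= [bs].
  move=> /(IH _ bs)[s1 [t' [s2 [-> sub]]]]; exists (t :: s1), t', s2; split=> // x.
  by rewrite !inE => /orP[->//|/sub ->]; rewrite orbT.
by move=> _; exists [::], t, s; split=> // x; exact: mem_mask.
Qed.

Section directional.
Context {R : realType} {N m d k : nat} (B : hdiffop R N m d k).
Hypothesis k0 : (0 < k)%N.
Implicit Types (ps : seq ('rV[R]_N * 'rV[R]_m)) (M : 'rV[R]_d -> R).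

Definition symbol_dirs ps : seq 'rV[R]_d := [seq p.2 *m symbol B p.1 | p <- ps].

Lemma iter_diff_symbol_zero M ps p : p \in ps -> p.1 = 0 ->
  iter_diff M (symbol_dirs ps) = fun=> 0.
Proof.
move=> /splitPr[s1 s2] p0; rewrite /symbol_dirs map_cat map_cons p0 symbol0// mulmx0.
by rewrite iter_diff_cat iter_diff_cons dird0 iter_diff_zero.
Qed.

(* If the tail [s2] is free then [size s2 <= N], hence [k < size s2]. As a function of the head
   frequency the derivative has degree at most [k] and vanishes on all proper subsums of the
   linear combination of [s2] by induction, so it vanishes on the whole combination. *)
Lemma iter_diff_nfree M : polyf M ->
  (forall ps, (2 <= size ps)%N -> (size ps <= (minn k N).+1)%N ->
     (forall p, p \in ps -> p.1 != 0) -> ~~ free [seq p.1 | p <- ps] ->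
     iter_diff M (symbol_dirs ps) = fun=> 0) ->
  forall ps, ~~ free [seq p.1 | p <- ps] -> iter_diff M (symbol_dirs ps) = fun=> 0.
Proof.
move=> pM H ps; have [n] := ubnP (size ps); elim: n ps => // n IH ps.
rewrite ltnS => psn nf.
have [/hasP[p pps /eqP p0]|/hasPn nz] := boolP (has (fun p => p.1 == 0) ps).
  exact: iter_diff_symbol_zero pps p0.
have [small|big] := leqP (size ps) (minn k N).+1.
  have [two|] := leqP 2 (size ps); first exact: H.
  case: ps nf nz {psn small} => [|p [|q ps]] //=; first by rewrite nil_free.
  by rewrite seq1_free negbK => /eqP p0 /(_ p); rewrite mem_head p0 eqxx => /(_ isT).
(* If the frequency in the span of its successors is not the first, a shorter dependent tail already
   gives zero, and the remaining derivatives act on the zero function. *)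
have [[|p1 s1] [p [s2 [psE ps2]]]] := nfree_split nf; last first.
  rewrite psE /symbol_dirs map_cat iter_diff_cat -/(symbol_dirs (p :: s2)) IH ?iter_diff_zero//.
    by rewrite (leq_trans _ psn)// psE size_cat /= addSn ltnS addnS ltnS leq_addl.
  by rewrite map_cons free_cons ps2.
have [fr2|nfr2] := boolP (free [seq p.1 | p <- s2]); last first.
  rewrite psE cat0s /symbol_dirs map_cons iter_diff_cons -/(symbol_dirs s2) IH ?dird_cst//.
  by rewrite (leq_trans _ psn)// psE.
have kN : (k < size s2)%N.
  have s2N : (size s2 <= N)%N.
    by move: fr2; rewrite /free size_map => /eqP <-;
      rewrite (leq_trans (dimvS (subvf _)))// dimvf /dim /= mul1n.
  move: big; rewrite psE /= ltnS; rewrite gtn_min => /orP[//|Ns2].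
  by move: (leq_trans Ns2 s2N); rewrite ltnn.
rewrite psE cat0s; apply/funext => x.
have [Z [Zs2 p1E]] := span_zip ps2.
pose g (xi : 'rV[R]_N) := iter_diff M (symbol_dirs ((xi, p.2) :: s2)) x.
have -> : iter_diff M (symbol_dirs (p :: s2)) x = g (\sum_(z <- Z) z.1 *: z.2.1).
  by rewrite -p1E /g; case: (p).
have gE xi : g xi = \sum_j (\sum_a p.2 0 a * symbol B xi a j) *
    dird (delta_mx 0 j) (iter_diff M (symbol_dirs s2)) x.
  rewrite /g /symbol_dirs map_cons iter_diff_cons dird_sum; apply: eq_bigr => j _.
  by rewrite mxE.
have deg_g : deg_lt (size Z) g.
  apply: (@deg_ltW _ _ k.+1); first by rewrite -(size_map (fun z => z.2)) Zs2.
  have -> : g = (fun xi => \sum_j dird (delta_mx 0 j) (iter_diff M (symbol_dirs s2)) x *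
      (\sum_a p.2 0 a * symbol B xi a j)).
    by apply/funext => xi; rewrite gE; apply: eq_bigr => j _; rewrite mulrC.
  apply: deg_lt_sum => j; apply: deg_lt_scale; apply: deg_lt_sum => a.
  by apply: deg_lt_scale; exact: deg_lt_symbol.
apply: (deg_lt_subsums deg_g) => b bZ nb.
(* The subsum [xi] does not involve [z], so without [z] the list is still dependent and shorter; the
   derivative along [z] is then applied to zero. *)
have [Z1 [z [Z2 [ZE sub]]]] := mask_remove bZ nb.
pose xi := \sum_(i <- mask b Z) i.1 *: i.2.1.
have E : iter_diff M (symbol_dirs ((xi, p.2) :: [seq i.2 | i <- Z1 ++ Z2])) = fun=> 0.
  apply: IH.
    rewrite (leq_trans _ psn)// psE -Zs2 ZE /= !size_map !size_cat /= addnS.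
    exact: leqnn.
  rewrite map_cons free_cons negb_and negbK; apply/orP; left => /=.
  rewrite /xi big_seq; apply: memv_suml => i /sub iZ.
  by apply: memvZ; apply: memv_span; rewrite -map_comp; exact: (map_f (fun z => z.2.1)).
have -> : g xi = iter_diff M (symbol_dirs ((xi, p.2) :: [seq i.2 | i <- Z1]) ++
    (z.2.2 *m symbol B z.2.1) :: symbol_dirs [seq i.2 | i <- Z2]) x.
  by rewrite /g -Zs2 ZE /symbol_dirs !(map_cat, map_cons).
rewrite iter_diff_mid// iter_diff_cons.
rewrite [X in iter_diff M X](_ : _ = symbol_dirs ((xi, p.2) :: [seq i.2 | i <- Z1 ++ Z2])).
  by rewrite E dird_cst.
by rewrite /symbol_dirs !map_cons map_cat [in RHS]map_cat cat_cons.
Qed.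

End directional.

(** * Sufficiency *)

Lemma cper_comp_field (R : realType) (N d : nat) (M : 'rV[R]_d -> R) v
    (u : 'rV[R]_N -> 'rV[R]_d) : continuous M -> continuous u -> unit_periodic u ->
  cper (fun y => M (v + u y)).
Proof.
move=> cM cu pu; split=> [|x i]; last by rewrite pu.
move=> x; apply: (@continuous_comp _ _ _ (fun y => v + u y) M); last exact: cM.
by apply: continuousD; [exact: cst_continuous|exact: cu].
Qed.

Definition wave_prod (R : realType) (N d : nat) (L : seq (wave R N d)) (y : 'rV[R]_N) : R :=
  \prod_(q <- L) pcos q.2.1 q.2.2 y.

Lemma cper_wave_prod (R : realType) (N d : nat) (L : seq (wave R N d)) :
  (forall q, q \in L -> int_row q.2.2) -> cper (wave_prod L).
Proof.
move=> Li; have := @cper_prod_pcos R N [seq q.2 | q <- L].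
rewrite (_ : (fun x => _) = wave_prod L); first by apply=> _ /mapP[q /Li qi ->].
by apply/funext => x; rewrite big_map.
Qed.

Lemma waves_cons (R : realType) (N d : nat) (q : wave R N d) L x :
  waves (q :: L) x = pcos q.2.1 q.2.2 x *: q.1 + waves L x.
Proof. by rewrite /waves big_cons. Qed.

Section sufficiency.
Context {R : realType} {N m d k : nat} (B : hdiffop R N m d k).
Hypothesis k0 : (0 < k)%N.
Variable M : 'rV[R]_d -> R.
Hypothesis pM : polyf M.
Hypothesis MB : forall ps : seq ('rV[R]_N * 'rV[R]_m),
  ~~ free [seq p.1 | p <- ps] -> iter_diff M (symbol_dirs B ps) = fun=> 0.

(* [z = (th, (n, w))] encodes the wave of phase [th], frequency [n] and amplitude [B[n] w]. *)
Let wv (z : R * ('rV[R]_N * 'rV[R]_m)) : wave R N d :=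
  (z.2.2 *m symbol B z.2.1, (z.1, z.2.1)).

Let dirs (Z : seq (R * ('rV[R]_N * 'rV[R]_m))) := symbol_dirs B [seq z.2 | z <- Z].

(* Adding the wave [j] produces a second term with the factor
   [wave_prod (j :: ks) * iter_diff M (dirs (j :: ks))]: the derivative vanishes when the
   frequencies are dependent, the mean of the cosines when they are free. *)
Lemma torus_integral_waves_expand (js ks : seq (R * ('rV[R]_N * 'rV[R]_m))) v :
  (forall z, z \in js ++ ks -> int_row z.2.1) ->
  torus_integral (fun y => wave_prod (map wv ks) y * iter_diff M (dirs ks) (v +
    waves (map wv js) y)) =
  torus_integral (wave_prod (map wv ks)) * iter_diff M (dirs ks) v.
Proof.
elim: js ks => [|j js IH] ks Hi.
  have cw : cper (wave_prod (map wv ks)).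
    apply: cper_wave_prod => _ /mapP[z zk ->].
    by apply: Hi; rewrite mem_cat zk orbT.
  move: (iter_diff M (dirs ks)) => F.
  rewrite mulrC -(torus_integralZ _ cw); congr torus_integral; apply/funext => y.
  by rewrite /waves big_nil addr0 mulrC.
have Hk : forall q, q \in map wv ks -> int_row q.2.2.
  by move=> _ /mapP[z zk ->]; apply: Hi; rewrite mem_cat zk orbT.
have Hj : forall q, q \in map wv js -> int_row q.2.2.
  by move=> _ /mapP[z zk ->]; apply: Hi; rewrite inE mem_cat zk orbT.
have Hjk : forall q, q \in map wv (j :: ks) -> int_row q.2.2.
  by move=> _ /mapP[z zk ->]; apply: Hi; rewrite inE mem_cat; move: zk; rewrite inE =>
    /orP[->|->]; rewrite ?orbT.
set F := iter_diff M (dirs ks).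
have pF : polyf F by exact: polyf_iter_diff.
(* A repeated frequency is dependent, so [F] is affine along the amplitude of [j]. *)
have F2 : dird (wv j).1 (dird (wv j).1 F) = fun=> 0.
  rewrite -!iter_diff_cons -[X in iter_diff M X]/(dirs (j :: j :: ks)); apply: MB.
  by rewrite !map_cons free_cons memv_span ?mem_head.
have dF : dird (wv j).1 F = iter_diff M (dirs (j :: ks)) by rewrite -iter_diff_cons.
have cF G (pG : polyf G) : cper (fun y => G (v + waves (map wv js) y)).
  apply: cper_comp_field; [exact: polyf_continuous|exact: waves_continuous|exact: waves_periodic].
have -> : (fun y => wave_prod (map wv ks) y * F (v + waves (map wv (j :: js)) y)) =
  (fun y => wave_prod (map wv ks) y * F (v + waves (map wv js) y) +
            wave_prod (map wv (j :: ks)) y * dird (wv j).1 F (v + waves (map wv js) y)).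
  apply/funext => y; rewrite map_cons waves_cons addrA addrAC polyf_affine//.
  rewrite /wave_prod map_cons big_cons mulrDr mulrA; congr (_ + _ * _).
  by rewrite mulrC.
rewrite torus_integralD; last 2 first.
- by apply: cperM; [exact: cper_wave_prod|exact: cF].
- by apply: cperM; [exact: cper_wave_prod|apply: cF; exact: polyf_dird].
rewrite IH; last by move=> z zjk; apply: Hi; rewrite inE zjk orbT.
rewrite dF IH; last first.
  by move=> z; rewrite mem_cat inE => /or3P[zj|/eqP ->|zk]; apply: Hi;
    rewrite !inE ?eqxx// mem_cat ?zj ?zk ?orbT.
rewrite -[RHS]addr0; congr (_ + _).
have [fr|nfr] := boolP (free [seq p.1 | p <- [seq z.2 | z <- j :: ks]]);
  last by rewrite (MB nfr) mulr0.
suff -> : torus_integral (wave_prod (map wv (j :: ks))) = 0 by rewrite mul0r.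
have := @torus_integral_prod_pcos_free R N (wv j).2 [seq q.2 | q <- map wv ks].
rewrite -[_ :: _]/([seq q.2 | q <- map wv (j :: ks)]).
rewrite (_ : (fun x => _) = wave_prod (map wv (j :: ks))); last first.
  by apply/funext => x; rewrite /wave_prod big_map.
apply; first by move=> _ /mapP[q /Hjk qi ->].
by rewrite -!map_comp; rewrite -map_comp in fr.
Qed.

Lemma torus_integral_free_waves l kA (A : hdiffop R N d l kA) (L : seq (wave R N d)) v :
  potential A B -> (forall q, q \in L -> free_wave A q) ->
  torus_integral (fun y => M (v + waves L y)) = M v.
Proof.
move=> AB LA.
have [Z ZE] : exists Z, L = map wv Z.
  elim: L LA => [|[u [th n]] L IH] LA; first by exists [::].
  have [|Z ->] := IH; first by move=> q qL; apply: LA; rewrite inE qL orbT.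
  have [/= ni n0 /sub_kermxP un] := LA _ (mem_head _ _).
  have /eqmxP BA := AB _ n0; move: un; rewrite -BA => /submxP[w ->].
  by exists ((th, (n, w)) :: Z).
have := @torus_integral_waves_expand Z [::] v.
rewrite -ZE /wave_prod; under [X in torus_integral X]funext do rewrite big_nil mul1r.
under [X in torus_integral X * _]funext do rewrite big_nil.
rewrite torus_integral_cst mul1r => -> // z; rewrite cats0 => zZ.
by have [] := LA (wv z); [rewrite ZE map_f|].
Qed.

Lemma quasiaffine_sufficient l kA (A : hdiffop R N d l kA) : potential A B -> quasiaffine A M.
Proof.
move=> AB; have cM := polyf_continuous pM; split=> // v psi sp pp Ap p0.
have cp := smooth_continuous sp.
have /choice[C HC] : forall j, exists C, forall y, `|psi y 0 j| <= C.
  by move=> j; apply: cper_bounded; exact: cper_coord.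
(* A box containing all values [v + psi y]. The approximating waves may leave it, which the modulus
   around a compact set allows. *)
pose K := [set x : 'rV[R]_d | forall j, x ord0 j \in `[(v 0 j - C j)%R, (v 0 j + C j)%R]%R].
have cK : compact K.
  apply: (@rV_compact R d (fun j => `[(v 0 j - C j)%R, (v 0 j + C j)%R]%classic)) => j.
  exact: segment_compact.
have Kp y : K (v + psi y).
  move=> j; rewrite mxE in_itv/=; have := HC j y; rewrite ler_norml => /andP[h1 h2].
  by apply/andP; split; lra.
apply/eqP; rewrite eq_sym -subr_eq0 -normr_le0; apply/ler_addgt0Pl => e e0; rewrite addr0.
have [dl dl0 H] := continuous_compact_modulus cK cM e0.
have [L [LA Lp]] := wave_approx sp pp Ap p0 dl0.
have Lw q : q \in L -> int_row q.2.2 by move=> /LA[].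
have c1 : cper (fun y => M (v + psi y)) by exact: cper_comp_field.
have c2 : cper (fun y => M (v + waves L y)).
  by apply: cper_comp_field => //; [exact: waves_continuous|exact: waves_periodic].
rewrite -(torus_integral_free_waves v AB LA) -torus_integralB//.
apply: normr_torus_integral_le; first exact: cperB.
move=> y; apply: H => //.
by rewrite opprD addrACA subrr add0r -opprB normrN.
Qed.

End sufficiency.

(** * Necessity *)

Section mean_value.
Context {R : realType} {N : nat} (n : 'rV[R]_N).
Hypotheses (ni : int_row n) (n0 : n != 0).
Let c := pcos 0 n.

(** A mean value property in one variable, with [t] as radius and the distribution of the cosine as
    weight. Its solutions are treated like harmonic functions, by a maximum principle. *)
Definition cos_mean (f : R -> R) : Prop :=
  continuous f /\ forall s t, f s = torus_integral (fun y => f (s + t * c y)).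

Let cc : cper c. Proof. exact: cper_pcos. Qed.

Let cper_f (f : R -> R) s t : continuous f -> cper (fun y => f (s + t * c y)).
Proof.
by move=> cf; apply: (cper_comp cf); apply: cperD; [exact: cper_cst|exact: cperZ].
Qed.

Lemma torus_integral_pcos_sqr : torus_integral (fun y => c y ^+ 2) = 2^-1.
Proof.
have ni2 : int_row (n + n) by move=> i; rewrite mxE rpredD.
have n20 : n + n != 0 by rewrite -mulr2n -scaler_nat scaler_eq0 pnatr_eq0.
have -> : (fun y => c y ^+ 2) = (fun y => 2^-1 + 2^-1 * pcos 0 (n + n) y).
  apply/funext => y; rewrite expr2 /c /pcos cosM subrr cos0 mulr1 addrC dotvDl.
  by congr (_ + _ * cos _); ring.
rewrite torus_integralD; [|exact: cper_cst|exact/cperZ/cper_pcos].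
by rewrite torus_integral_cst torus_integralZ ?torus_integral_pcos ?mulr0 ?addr0//; exact:
  cper_pcos.
Qed.

(* The small parabola [e (s - a) (s - b)] makes the mean value inequality strict at a maximum. *)
Lemma cos_mean_le0 (f : R -> R) a b x : cos_mean f -> f a = 0 -> f b = 0 ->
  a <= x <= b -> f x <= 0.
Proof.
move=> [cf mf] fa fb /andP[ax xb]; rewrite leNgt; apply/negP => fx.
pose D := (x - a) * (b - x).
have D0 : 0 <= D by rewrite mulr_ge0// subr_ge0.
(* Makes [e * D < f x], so that [g x] is positive while [g] vanishes at [a] and [b]: the maximum is
   interior. *)
pose e := f x / (2 * (D + 1)).
have e0 : 0 < e by rewrite divr_gt0// mulr_gt0// ltr_wpDl.
pose g s := f s + e * ((s - a) * (s - b)).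
have cq : continuous (fun s => e * ((s - a) * (s - b))).
  apply: continuous_mulf; first exact: cst_continuous.
  by apply: continuous_mulf; apply: continuous_addf;
    [by move=> s; exact: cvg_id|exact: cst_continuous|by move=> s; exact: cvg_id|exact:
      cst_continuous].
have cg : continuous g by exact: continuous_addf.
have gx : 0 < g x.
  have -> : g x = f x - e * D by rewrite /g /D; ring.
  rewrite subr_gt0 /e mulrAC ltr_pdivrMr ?mulr_gt0 ?ltr_wpDl// ltr_pM2l//; lra.
have [s0 s0ab Hmax] := @EVT_max R g a b (le_trans ax xb) (continuous_subspaceT cg).
have gs0 : 0 < g s0 by apply: lt_le_trans (Hmax x _); rewrite ?in_itv/= ?ax.
have ga : g a = 0 by rewrite /g fa subrr mul0r mulr0 addr0.
have gb : g b = 0 by rewrite /g fb subrr mulr0 mulr0 addr0.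
move: s0ab; rewrite in_itv/= => /andP[as0 s0b].
have as0' : a < s0.
  by rewrite lt_neqAle as0 andbT; apply/eqP => E; move: gs0; rewrite -E ga ltxx.
have s0b' : s0 < b.
  by rewrite lt_neqAle s0b andbT; apply/eqP => E; move: gs0; rewrite E gb ltxx.
(* The largest radius for which [s0 + t * c y] stays in [[a, b]]. *)
pose t := Num.min (s0 - a) (b - s0).
have t0 : 0 < t by rewrite lt_min !subr_gt0 as0'.
have ta : t <= s0 - a by rewrite ge_min lexx.
have tb : t <= b - s0 by rewrite ge_min lexx orbT.
have gle y : g (s0 + t * c y) <= g s0.
  apply: Hmax; rewrite in_itv/=.
  have h1 : -1 <= c y by exact: cos_geN1.
  have h2 : c y <= 1 by exact: cos_le1.
  have h3 : - t <= t * c y by rewrite -mulrN1 ler_pM2l.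
  have h4 : t * c y <= t by rewrite -[leRHS]mulr1 ler_pM2l.
  by apply/andP; split; lra.
have cgy := cper_f s0 t cg.
have := le_torus_integral cgy (@cper_cst R N (g s0)) gle.
rewrite torus_integral_cst.
(* The cosine has mean zero and its square has mean [2^-1], so the mean of [g] exceeds [g s0] by
   [e * t ^+ 2 * 2^-1], a contradiction. *)
have -> : (fun y => g (s0 + t * c y)) = (fun y => f (s0 + t * c y) +
   (e * ((s0 - a) * (s0 - b)) + (e * t * (s0 - b + (s0 - a)) * c y + e * t ^+ 2 * c y ^+ 2))).
  by apply/funext => y; rewrite /g; ring.
have cc2 : cper (fun y => c y ^+ 2) by apply: cperM.
rewrite torus_integralD; [|exact: cper_f|by apply: cperD; [exact: cper_cst|apply: cperD; exact:
  cperZ]].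
rewrite -mf torus_integralD; [|exact: cper_cst|by apply: cperD; exact: cperZ].
rewrite torus_integral_cst torus_integralD; [|exact: cperZ|exact: cperZ].
rewrite torus_integralZ// torus_integralZ// torus_integral_pcos_sqr (torus_integral_pcos 0 ni n0).
rewrite /g mulr0 add0r; have : 0 < e * t ^+ 2 * 2^-1 by rewrite (mulr_gt0 (mulr_gt0 e0 (exprn_gt0
  2 t0)))// invr_gt0 ltr0n.
lra.
Qed.

(** On an interval containing [0], [1] and [t], the maximum principle applies to the difference
    between [f] and its chord, and, through the sign [sg], to its negative. *)
Lemma cos_mean_affine (f : R -> R) t : cos_mean f -> f t = f 0 + t * (f 1 - f 0).
Proof.
move=> fm; have [cf mf] := fm.
pose a := - `|t| - 1; pose b := `|t| + 1.
have ta : a <= t <= b.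
  by have := ler_norm t; have := ler_norm (- t); rewrite normrN /a /b => *; apply/andP; split; lra.
have t0 := normr_ge0 t.
have ab : 0 < b - a by rewrite /a /b; lra.
pose k := (f b - f a) / (b - a).
have kab : k * (b - a) = f b - f a by rewrite /k divfK// gt_eqF.
pose h (sg : R) s := sg * (f s + -1 * (f a + k * (s - a))).
have hm sg : cos_mean (h sg).
  have ch : continuous (h sg).
    apply: continuous_mulf; first exact: cst_continuous.
    apply: continuous_addf; first exact: cf.
    apply: continuous_mulf; first exact: cst_continuous.
    apply: continuous_addf; first exact: cst_continuous.
    apply: continuous_mulf; first exact: cst_continuous.
    by apply: continuous_addf; [by move=> s; exact: cvg_id|exact: cst_continuous].
  split=> // s u; rewrite /h.
  have -> : (fun y => sg * (f (s + u * c y) + -1 * (f a + k * (s + u * c y - a)))) =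
     (fun y => sg * f (s + u * c y) + (- sg * (f a + k * (s - a)) + (- (sg * k * u)) * c y)).
    by apply/funext => y; ring.
  rewrite torus_integralD; [|exact/cperZ/cper_f|by apply: cperD; [exact: cper_cst|exact: cperZ]].
  rewrite torus_integralZ ?torus_integralD//; [|exact: cper_cst|exact: cperZ|exact: cper_f].
  rewrite -mf torus_integral_cst torus_integralZ// (torus_integral_pcos 0 ni n0); ring.
have ha sg : h sg a = 0 by rewrite /h subrr mulr0 addr0 mulN1r subrr mulr0.
have hb sg : h sg b = 0 by rewrite /h kab; ring.
have eq s : a <= s <= b -> f s = f a + k * (s - a).
  move=> asb; apply/eqP; rewrite eq_le.
  have := cos_mean_le0 (hm 1) (ha 1) (hb 1) asb.
  have := cos_mean_le0 (hm (-1)) (ha (-1)) (hb (-1)) asb.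
  by rewrite /h => *; apply/andP; split; lra.
have b0 : a <= 0 <= b by rewrite /a /b; apply/andP; split; lra.
have b1 : a <= 1 <= b by rewrite /a /b; apply/andP; split; lra.
by rewrite (eq t ta) (eq 0 b0) (eq 1 b1); ring.
Qed.

End mean_value.

Section necessity.
Context {R : realType} {N d l m kA kB : nat}.
Variables (A : hdiffop R N d l kA) (B : hdiffop R N m d kB) (M : 'rV[R]_d -> R).
Hypotheses (kB0 : (0 < kB)%N) (A_spanning : spanning A) (AB : potential A B).
Hypothesis qM : quasiaffine A M.

Lemma quasiaffine_free_waves (L : seq (wave R N d)) v :
  (forall q, q \in L -> free_wave A q) ->
  torus_integral (fun y => M (v + waves L y)) = M v.
Proof.
move=> LA; have [_ H] := qM; rewrite -H//.
- exact: smooth_waves.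
- by apply: waves_periodic => q /LA[].
- by apply: apply_op_waves => q /LA[].
move=> j; under [X in torus_integral X]funext do rewrite wavesE.
elim: L LA => [|q L IH] LA.
  by under [X in torus_integral X]funext do rewrite big_nil; rewrite torus_integral_cst.
have LA' p : p \in L -> free_wave A p by move=> pL; apply: LA; rewrite inE pL orbT.
under [X in torus_integral X]funext do rewrite big_cons.
have [qi q0 _] := LA _ (mem_head _ _).
rewrite torus_integralD; last 2 first.
- exact/cperZ/cper_pcos.
- rewrite (_ : (fun y => _) = (fun y => waves L y 0 j)); last first.
    by apply/funext => y; rewrite wavesE.
  apply: cper_coord; first exact: waves_continuous.
  by apply: waves_periodic => p /LA'[].
by rewrite IH// addr0 torus_integralZ ?torus_integral_pcos ?mulr0//; exact: cper_pcos.
Qed.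

Lemma quasiaffine_affine u th n : free_wave A (u, (th, n)) ->
  forall v t, M (v + t *: u) = M v + t * (M (v + u) - M v).
Proof.
move=> [/= ni n0 un] v t.
have [cM _] := qM.
pose f s := M (v + s *: u).
have fm : cos_mean n f.
  split.
    move=> s; apply: (@continuous_comp _ _ _ (fun s : R => v + s *: u) M); last exact: cM.
    by apply: continuousD; [exact: cst_continuous|exact: scalel_continuous].
  move=> s r; rewrite [LHS]/f -(@quasiaffine_free_waves [:: (r *: u, (0, n))] (v + s *: u));
    last first.
    by move=> q; rewrite inE => /eqP ->; split=> //=; rewrite -scalemxAl un scaler0.
  congr torus_integral; apply/funext => y.
  by rewrite /f /waves big_seq1 /= scalerA scalerDl addrA mulrC.
by have := cos_mean_affine ni n0 t fm; rewrite /f scale0r addr0 scale1r.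
Qed.

(** The grid on which [linepoly_eq0] tests a function. *)
Definition pos_row (n : 'rV[R]_N) := forall i, exists k : nat, n 0 i = k.+1%:R.

Lemma pos_row_int n : pos_row n -> int_row n.
Proof. by move=> np i; have [k ->] := np i; exact: rpred_nat. Qed.

Lemma symbol_free_wave n w th : int_row n -> n != 0 -> free_wave A (w *m symbol B n, (th, n)).
Proof.
move=> ni n0; split=> //=; apply/sub_kermxP.
by have /eqmxP <- := AB n0; exact: submxMl.
Qed.

Definition free_dir (u : 'rV[R]_d) := u = 0 \/ exists n, free_wave A (u, (0, n)).

Lemma pos_free_dir n w : pos_row n -> free_dir (w *m symbol B n).
Proof.
move=> np; have [->|n0] := eqVneq n 0; first by left; rewrite symbol0// mulmx0.
by right; exists n; apply: symbol_free_wave => //; exact: pos_row_int.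
Qed.

Lemma free_dir_affine u v t : free_dir u -> M (v + t *: u) = M v + t * (M (v + u) - M v).
Proof.
move=> [->|[n un]]; last exact: quasiaffine_affine un _ _.
by rewrite scaler0 !addr0 subrr mulr0 addr0.
Qed.

(** The spanning property supplies kernel vectors at real frequencies, while free directions come
    from integer ones. If the span [U] of free directions cannot grow, the part of
    [w *m symbol B eta] outside [U] is polynomial in [eta] and vanishes on the positive integer
    grid, hence everywhere. *)
Lemma free_dir_span : exists2 us : seq 'rV[R]_d, (forall u, u \in us -> free_dir u) & <<us>>%VS =
  fullv.
Proof.
(* The dimension of the span grows with [r] until it is stuck; [r = d.+1] is out of reach. *)
suff H r : exists2 us : seq 'rV[R]_d, (forall u, u \in us -> free_dir u) &
    <<us>>%VS = fullv \/ (r <= \dim <<us>>)%N.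
  have [us uf [full|big]] := H d.+1; first by exists us.
  have := dimvS (subvf <<us>>%VS); rewrite dimvf /dim /= mul1n => le.
  by move: (leq_trans big le); rewrite ltnn.
elim: r => [|r [us uf [full|big]]]; first by exists [::] => //; right.
  by exists us => //; left.
have [[u [fu uus]]|nu] := pselect (exists u, free_dir u /\ u \notin <<us>>%VS).
  exists (u :: us).
    by move=> x; rewrite inE => /orP[/eqP ->//|]; exact: uf.
  right; apply: (leq_ltn_trans big).
  have sub : (<<us>> <= <<u :: us>>)%VS by rewrite span_cons addvSr.
  rewrite (ltn_leqif (dimv_leqif_sup sub)); apply: contra uus => /subvP; apply.
  by rewrite memv_span ?mem_head.
exists us => //; left; apply/eqP; rewrite eqEsubv subvf /=.
have [s [sA <-]] := A_spanning; apply/span_subvP => v /sA[xi [xi0 /sub_kermxP]].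
have /eqmxP <- := AB xi0 => /submxP[w ->].
set U := <<us>>%VS.
have E (x : 'rV[R]_d) :
    x - projv U x = \sum_i x 0 i *: (delta_mx 0 i - projv U (delta_mx 0 i)).
  under eq_bigr do rewrite scalerBr -linearZ.
  by rewrite sumrB -linear_sum -row_sum_delta.
have key j : forall eta : 'rV[R]_N, (w *m symbol B eta - projv U (w *m symbol B eta)) 0 j = 0.
  apply: linepoly_eq0.
    rewrite (_ : (fun eta => _) = (fun eta : 'rV[R]_N => \sum_i (w *m symbol B eta) 0 i *
        (delta_mx 0 i - projv U (delta_mx 0 i) : 'rV[R]_d) 0 j)); last first.
      apply/funext => eta; rewrite E summxE; apply: eq_bigr => i _.
      by rewrite mxE.
    apply: linepoly_sum => i; apply: linepolyM; last exact: linepoly_cst.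
    exact: linepoly_mul_symbol.
  move=> n np; have fn : free_dir (w *m symbol B n).
    by apply: pos_free_dir => i; exact: np.
  rewrite projv_id ?subrr ?mxE//; apply/negPn/negP => nU; apply: nu.
  by exists (w *m symbol B n).
have -> : w *m symbol B xi = projv U (w *m symbol B xi).
  by apply/eqP; rewrite -subr_eq0; apply/eqP/rowP => j; rewrite key mxE.
exact: memv_proj.
Qed.

Lemma quasiaffine_polyf : polyf M.
Proof.
have [us uf full] := free_dir_span.
pose X := in_tuple us.
apply: (@polyf_multiaffine _ _ _ 'I_(size us) (index_enum _) (fun i => X`_i)
   (fun i x => coord X i x)).
- move=> i; rewrite (_ : (fun x => _) = (fun x : 'rV[R]_d =>
  \sum_j x 0 j * coord X i (delta_mx 0 j))).
    apply: polyf_sum => j; apply: polyfM; [exact: polyf_coord|exact: polyf_cst].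
  apply/funext => x; rewrite [x in LHS]row_sum_delta linear_sum.
  by apply: eq_bigr => j _; rewrite linearZ.
- by move=> i v t; apply: free_dir_affine; apply: uf; rewrite mem_nth.
- by move=> x; apply: coord_span; rewrite full memvf.
Qed.

Lemma free_wave_dird2 u th n : free_wave A (u, (th, n)) -> dird u (dird u M) = fun=> 0.
Proof.
move=> un; have pM := quasiaffine_polyf.
have aff := quasiaffine_affine un.
(* By affinity the derivative along [u] is a difference, which is constant along [u]. *)
have d1 : dird u M = fun x => M (x + u) - M x.
  apply/funext => x; rewrite dirdE//.
  suff [_] : is_derive x u M (M (x + u) - M x) by [].
  apply: is_derive_from_line.
  rewrite (_ : (fun h => _) = (fun h => M x + h * (M (x + u) - M x))); last first.
    by apply/funext => h; rewrite addrC aff.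
  apply: is_derive_eq.
  by rewrite scale0r !add0r mul1r [_ *: 1]mulr1.
apply/funext => x; rewrite dirdE; last exact: polyf_dird.
suff [_] : is_derive x u (dird u M) 0 by [].
apply: is_derive_from_line.
rewrite (_ : (fun h => _) = cst (dird u M x)); first exact: is_derive_cst.
apply/funext => h; rewrite d1 /= [h *: u + x]addrC -addrA -{2}[u]scale1r -scalerDl !aff; ring.
Qed.

(* [M] is affine along the amplitude [u] of a wave with cosine [c], so that
   [c * D_u F z = F (z + c u) - F z] moves a wave from [ks] to [js]. *)
Lemma torus_integral_waves_iter_diff (ks js : seq (wave R N d)) v :
  (forall q, q \in ks ++ js -> free_wave A q) ->
  torus_integral (fun y => wave_prod ks y * iter_diff M [seq q.1 | q <- ks] (v + waves js y)) =
  if ks is [::] then M v else 0.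
Proof.
have pM := quasiaffine_polyf.
elim: ks js => [|q ks IH] js H.
  rewrite -(@quasiaffine_free_waves js)//; congr torus_integral; apply/funext => y.
  by rewrite /wave_prod big_nil mul1r.
have kI : forall p, p \in ks -> int_row p.2.2.
  by move=> p pk; have [] := H p; rewrite // inE mem_cat pk orbT.
have jI : forall p, p \in js -> int_row p.2.2.
  by move=> p pk; have [] := H p; rewrite // inE mem_cat pk !orbT.
have qA : free_wave A q by apply: H; rewrite mem_head.
have [qI _ _] := qA.
set F := iter_diff M [seq p.1 | p <- ks].
have pF : polyf F by exact: polyf_iter_diff.
have F2 : dird q.1 (dird q.1 F) = fun=> 0.
  rewrite /F -!iter_diff_cons iter_diff_swap// iter_diff_swap; last exact: polyf_dird.
  have -> : dird q.1 (dird q.1 M) = fun=> 0.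
    by apply: (@free_wave_dird2 _ q.2.1 q.2.2); move: qA; case: (q) => u [th n].
  exact: iter_diff_zero.
have qjI : forall p, p \in q :: js -> int_row p.2.2.
  by move=> p; rewrite inE => /orP[/eqP ->//|]; exact: jI.
have cF (L : seq (wave R N d)) : (forall p, p \in L -> int_row p.2.2) ->
    cper (fun y => wave_prod ks y * F (v + waves L y)).
  move=> LI; apply: cperM; first exact: cper_wave_prod.
  apply: cper_comp_field; [exact: polyf_continuous|exact: waves_continuous|exact: waves_periodic].
have -> : (fun y => wave_prod (q :: ks) y * iter_diff M [seq p.1 | p <- q :: ks] (v + waves js y)) =
   (fun y => wave_prod ks y * F (v + waves (q :: js) y) - wave_prod ks y * F (v + waves js y)).
  apply/funext => y; rewrite map_cons iter_diff_cons -/F waves_cons addrA addrAC polyf_affine//.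
  rewrite /wave_prod big_cons.
  move: (F _) (dird _ _ _) (pcos _ _ _) (\prod_(i <- _) _) => a b c e.
  by ring.
rewrite torus_integralB; [|exact: cF|exact: cF].
rewrite !IH ?subrr//; move=> p pk; apply: H; move: pk; rewrite !(inE, mem_cat).
  by move=> /orP[->|->]; rewrite ?orbT.
by move=> /or3P[->|->|->]; rewrite ?orbT.
Qed.

End necessity.

(** * From positive integer combinations to all dependent frequencies *)

Section dependent_vanishing.
Context {R : realType} {N d l m kA kB : nat}.
Variables (A : hdiffop R N d l kA) (B : hdiffop R N m d kB) (M : 'rV[R]_d -> R).
Hypotheses (kB0 : (0 < kB)%N) (A_spanning : spanning A) (AB : potential A B).
Hypothesis qM : quasiaffine A M.

(* The waves with frequencies [z.1 *: z.2.1] and [\sum_z z.1 *: z.2.1] have a product of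
   cosines with positive mean. *)
Lemma pos_combination_vanishing w (Z : seq (R * ('rV[R]_N * 'rV[R]_m))) x :
  (forall z, z \in Z -> (exists k : nat, z.1 = k.+1%:R) /\ pos_row z.2.1) ->
  iter_diff M (symbol_dirs B ((\sum_(z <- Z) z.1 *: z.2.1, w) :: [seq z.2 | z <- Z])) x = 0.
Proof.
move=> HZ; set xi := \sum_(z <- Z) _; set ps := _ :: _.
have [/hasP[p pps /eqP p0]|/hasPn nz] := boolP (has (fun p => p.1 == 0) ps).
  by rewrite (iter_diff_symbol_zero B kB0 M pps p0).
have xiI : int_row xi.
  move=> i; rewrite /xi summxE big_seq rpred_sum// => z /HZ[[k zk] zp].
  by rewrite mxE zk rpredM//; [exact: rpred_nat|exact: pos_row_int].
(* The amplitude belongs to [z.2.1] but the frequency is its multiple; the wave is still free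
   because [symbol A] is homogeneous. The frequencies of these waves add up to [xi]. *)
pose wv (z : R * ('rV[R]_N * 'rV[R]_m)) : wave R N d := (z.2.2 *m symbol B z.2.1, (0, z.1 *:
  z.2.1)).
pose q0 : wave R N d := (w *m symbol B xi, (0, xi)).
pose ks := q0 :: [seq wv z | z <- Z].
have ksA q : q \in ks -> free_wave A q.
  rewrite inE => /orP[/eqP ->|/mapP[z zZ ->]].
    by apply: (symbol_free_wave AB) => //; exact: (nz (xi, w) (mem_head _ _)).
  have [[k zk] zp] := HZ _ zZ.
  have z0 : z.2.1 != 0 by apply: nz; rewrite inE map_f ?orbT.
  have [/= _ _ zA] := symbol_free_wave AB z.2.2 0 (pos_row_int zp) z0.
  split => /=.
  - by move=> i; rewrite mxE zk rpredM//; [exact: rpred_nat|exact: pos_row_int].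
  - by rewrite scaler_eq0 negb_or z0 andbT zk pnatr_eq0.
  - by rewrite symbolZ -scalemxAr zA scaler0.
have ksI q : q \in ks -> int_row q.2.2 by move=> /ksA[].
have ksA0 q : q \in ks ++ [::] -> free_wave A q by rewrite cats0; exact: ksA.
have : torus_integral (fun y => iter_diff M (symbol_dirs B ps) x * wave_prod ks y) = 0.
  rewrite -[RHS](torus_integral_waves_iter_diff kB0 A_spanning AB qM x ksA0).
  congr torus_integral; apply/funext => y; rewrite /waves big_nil addr0 mulrC.
  by congr (_ * iter_diff M _ x); rewrite /ps /symbol_dirs /ks !map_cons -!map_comp.
rewrite torus_integralZ; last exact: cper_wave_prod.
move/eqP; rewrite mulf_eq0 => /orP[/eqP //|].
have [|_ pos] := @torus_integral_prod_pcos0 R N xi [seq z.1 *: z.2.1 | z <- Z] xiI.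
  by move=> n /mapP[z zZ ->]; apply: (ksI (wv z)); rewrite inE map_f ?orbT.
have -> : wave_prod ks = (fun y => pcos 0 xi y * \prod_(n <- [seq z.1 *:
  z.2.1 | z <- Z]) pcos 0 n y).
  by apply/funext => y; rewrite /wave_prod /ks big_cons !big_map.
by rewrite gt_eqF// pos// big_map.
Qed.

(** The derivative is polynomial in the coefficients [c] for fixed frequencies [X], and in [X] for
    fixed [c]. Two uses of the identity principle reduce it to positive integers. *)
Lemma combination_vanishing w (Z : seq (R * ('rV[R]_N * 'rV[R]_m))) x :
  iter_diff M (symbol_dirs B ((\sum_(z <- Z) z.1 *: z.2.1, w) :: [seq z.2 | z <- Z])) x = 0.
Proof.
have pM := quasiaffine_polyf kB0 A_spanning AB qM.
pose r := size Z; pose z0 : R * ('rV[R]_N * 'rV[R]_m) := (0, (0, 0)).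
pose ws (i : 'I_r) := (nth z0 Z i).2.2.
pose c0 : 'rV[R]_r := \row_i (nth z0 Z i).1.
pose X0 : 'M[R]_(r, N) := \matrix_i (nth z0 Z i).2.1.
pose ZZ (c : 'rV[R]_r) (X : 'M[R]_(r, N)) := [seq (c 0 i, (row i X, ws i)) | i <- enum 'I_r].
have ZE : Z = ZZ c0 X0.
  apply: (@eq_from_nth _ z0); first by rewrite size_map size_enum_ord.
  move=> i iZ; rewrite (nth_map (Ordinal iZ)) ?size_enum_ord// mxE rowK /ws.
  by rewrite nth_enum_ord//; case: (nth z0 Z i) => a [b e].
(* [None] stands for the combined frequency, [Some i] for the others: the directions become the
   image of a fixed list, as [linepoly_iter_diff] requires. *)
pose f (c : 'rV[R]_r) (X : 'M[R]_(r, N)) (o : option 'I_r) :=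
  if o is Some i then ws i *m symbol B (row i X) else w *m symbol B (c *m X).
pose os := None :: [seq Some i | i <- enum 'I_r].
pose Phi c X := iter_diff M [seq f c X o | o <- os] x.
have PhiE c X : iter_diff M (symbol_dirs B ((\sum_(z <- ZZ c X) z.1 *: z.2.1, w) ::
  [seq z.2 | z <- ZZ c X])) x
   = Phi c X.
  have -> : \sum_(z <- ZZ c X) z.1 *: z.2.1 = c *m X by rewrite mulmx_sum_row /ZZ big_map big_enum.
  rewrite /Phi /symbol_dirs /os !map_cons; congr (iter_diff M (_ :: _) x).
  by rewrite /ZZ -!map_comp.
rewrite ZE PhiE.
have linX c : linepoly (Phi c).
  apply: (linepoly_iter_diff (f := fun o X => f c X o)) => // -[i|] _ j /=.
    exact: (linepoly_comp (row i) (linepoly_mul_symbol B (ws i) j)).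
  exact: (linepoly_comp (mulmx c) (linepoly_mul_symbol B w j)).
have linc X : linepoly (fun c => Phi c X).
  apply: (linepoly_iter_diff (f := fun o c => f c X o)) => // -[i|] _ j /=.
    exact: linepoly_cst.
  exact: (linepoly_comp (mulmxr X) (linepoly_mul_symbol B w j)).
move: c0 X0 {ZE} => c X; move: c; apply: (linepoly_eq0 (linc X)) => c cp.
move: X; apply: (linepoly_eq0 (linX c)) => X Xp.
rewrite -PhiE; apply: pos_combination_vanishing => z /mapP[i _ ->] /=; split; first exact: cp.
by move=> j; have [k Xk] := Xp i j; exists k; rewrite mxE.
Qed.

Lemma dependent_vanishing (ps : seq ('rV[R]_N * 'rV[R]_m)) x :
  ~~ free [seq p.1 | p <- ps] -> iter_diff M (symbol_dirs B ps) x = 0.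
Proof.
move=> nf; have [s1 [p [s2 [-> ps2]]]] := nfree_split nf.
have [Z [Zs2 pE]] := span_zip ps2.
rewrite /symbol_dirs map_cat iter_diff_cat -/(symbol_dirs B (p :: s2)).
have -> : iter_diff M (symbol_dirs B (p :: s2)) = fun=> 0.
  apply/funext => y; have := combination_vanishing p.2 Z y.
  by rewrite -pE Zs2; case: (p).
by rewrite iter_diff_zero.
Qed.

End dependent_vanishing.

Theorem theorem3p6 (R : realType) (N d l m kA kB : nat)
    (A : hdiffop R N d l kA) (B : hdiffop R N m d kB)
    (kA_ge1 : (1 <= kA)%N) (kB_ge1 : (1 <= kB)%N)
    (A_constant_rank : constant_rank A) (A_spanning : spanning A)
    (B_constant_rank : constant_rank B) (B_potential : potential A B)
    (M : 'rV[R]_d -> R) :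
  quasiaffine A M <->
  (polynomial_fun M /\
   forall r : nat, (2 <= r)%N -> (r <= (minn kB N).+1)%N ->
   forall xi : r.-tuple 'rV[R]_N,
     (forall i, tnth xi i != 0) -> ~~ free xi ->
   forall (w : r.-tuple 'rV[R]_m) (x : 'rV[R]_d),
     iter_diff M [seq tnth w i *m symbol B (tnth xi i) | i <- enum 'I_r] x = 0).
Proof.
split=> [qM|[/polynomial_funP pM H]].
  split; first exact/polynomial_funP/(quasiaffine_polyf kB_ge1 A_spanning B_potential qM).
  move=> r _ _ xi _ nf w x.
  have -> : [seq tnth w i *m symbol B (tnth xi i) | i <- enum 'I_r] =
      symbol_dirs B [seq (tnth xi i, tnth w i) | i <- enum 'I_r].
    by rewrite /symbol_dirs -[RHS]map_comp.
  apply: (dependent_vanishing kB_ge1 A_spanning B_potential qM).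
  by rewrite -map_comp (_ : map _ _ = xi)//= map_tnth_enum.
apply: (quasiaffine_sufficient pM _ B_potential).
apply: (iter_diff_nfree kB_ge1 pM) => ps ps2 psK nz nf; apply/funext => x.
pose xi : (size ps).-tuple 'rV[R]_N := [tuple (tnth (in_tuple ps) i).1 | i < size ps].
pose w : (size ps).-tuple 'rV[R]_m := [tuple (tnth (in_tuple ps) i).2 | i < size ps].
have psE : [seq tnth (in_tuple ps) i | i <- enum 'I_(size ps)] = ps by rewrite map_tnth_enum.
have xiE : xi = [seq p.1 | p <- ps] :> seq _ by rewrite -[in RHS]psE -map_comp.
have := H _ ps2 psK xi _ _ w x.
rewrite xiE => /(_ _ nf) <-; last first.
  by move=> i; rewrite tnth_mktuple; apply: nz; exact: mem_tnth.
congr (iter_diff M _ x); rewrite -[in LHS]psE /symbol_dirs -map_comp.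
by apply: eq_map => i /=; rewrite !tnth_mktuple.
Qed.
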